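(* Let $1\le p<\infty$, $n\ge1$ and let $Y$ be a Banach space over $\mathbb{K}$. Every continuous $n$-homogeneous polynomial $P:Y\to Y$ is factorable strongly $p$-summing if and only if $\dim Y<\infty$.
   Context: $\mathbb{K}=\mathbb{R}$ or $\mathbb{C}$. $\mathcal{P}(^nX;Y)$ is the space of continuous $n$-homogeneous polynomials from $X$ to $Y$, and $\mathcal{P}(^nX)=\mathcal{P}(^nX;\mathbb{K})$ with the sup norm on the unit ball of $X$. A polynomial $P\in\mathcal{P}(^nX;Y)$ is factorable strongly $p$-summing if there is $C\ge0$ such that for all positive integers $m_1,m_2$, all $x_j^i\in X$ and all scalars $\lambda_j^i$ ($1\le j\le m_1$, $1\le i\le m_2$), $$\left(\sum_{j=1}^{m_1}\Big\|\sum_{i=1}^{m_2}\lambda_j^iP(x_j^i)\Big\|^p\right)^{1/p}\le C\sup_{q\in\mathcal{P}(^nX),\,\|q\|\le1}\left(\sum_{j=1}^{m_1}\Big|\sum_{i=1}^{m_2}\lambda_j^iq(x_j^i)\Big|^p\right)^{1/p}.$$ *)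

(* Defs.v *)
From HB Require Import structures.
From mathcomp Require Import all_boot all_order all_algebra.
From mathcomp Require Import complex.
From mathcomp Require Import all_classical all_reals all_analysis.
Import Order.TTheory GRing.Theory Num.Theory numFieldNormedType.Exports.

Set Implicit Arguments.
Unset Strict Implicit.
Unset Printing Implicit Defensive.

Local Open Scope classical_set_scope.
Local Open Scope ring_scope.

Variant scalar_kind := RealScalars | ComplexScalars.

Definition scalar_field (R : realType) (s : scalar_kind) : numFieldType :=
  match s with
  | RealScalars => R
  | ComplexScalars => R[i]%C
  end.

Definition scalar_re (R : realType) (s : scalar_kind) :
    scalar_field R s -> R :=
  match s return scalar_field R s -> R with
  | RealScalars => fun x => x
  | ComplexScalars => fun z => complex.Re z
  end.

(* In a [normedModType K] the norm takes its values in [K] (in its nonnegative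
   real elements), hence the real part when [K] is the field [R[i]]. *)
Definition rnorm (R : realType) (s : scalar_kind)
    (V : normedModType (scalar_field R s)) (v : V) : R :=
  scalar_re `|v|.

Definition multilinear (K : numFieldType) (X Y : lmodType K) (n : nat)
    (A : ('I_n -> X) -> Y) : Prop :=
  forall (i : 'I_n) (x : 'I_n -> X), linear (fun u : X => A (dfwith x i u)).

Definition homogeneous_polynomial (K : numFieldType) (X Y : lmodType K)
    (n : nat) (P : X -> Y) : Prop :=
  exists2 A : ('I_n -> X) -> Y,
    multilinear A & forall x : X, P x = A (fun=> x).

Definition continuous_polynomial (K : numFieldType) (X Y : normedModType K)
    (n : nat) (P : X -> Y) : Prop :=
  homogeneous_polynomial n P /\ continuous P.

Definition polynomial_norm (R : realType) (s : scalar_kind)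
    (X Y : normedModType (scalar_field R s)) (P : X -> Y) : \bar R :=
  ereal_sup [set (rnorm (P x))%:E | x in [set x : X | rnorm x <= 1]].

Definition lp_combination (R : realType) (s : scalar_kind)
    (X Y : normedModType (scalar_field R s)) (p : R) (m1 m2 : nat)
    (lambda : 'I_m1 -> 'I_m2 -> scalar_field R s)
    (x : 'I_m1 -> 'I_m2 -> X) (P : X -> Y) : R :=
  (\sum_(j < m1) rnorm (\sum_(i < m2) lambda j i *: P (x j i)) `^ p) `^ p^-1.

(* The supremum is finite, since |q x| <= rnorm x ^+ n for every [q] in the
   unit ball; taking it in [\bar R] avoids the default value of [sup]. *)
Definition factorable_strongly_summing (R : realType) (s : scalar_kind)
    (X Y : normedModType (scalar_field R s)) (p : R) (n : nat)
    (P : X -> Y) : Prop :=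
  exists2 C : R, 0 <= C &
  forall (m1 m2 : nat), (0 < m1)%N -> (0 < m2)%N ->
  forall (x : 'I_m1 -> 'I_m2 -> X)
    (lambda : 'I_m1 -> 'I_m2 -> scalar_field R s),
  ((lp_combination p lambda x P)%:E <=
   C%:E * ereal_sup [set (lp_combination p lambda x q)%:E |
     q in [set q : X -> (scalar_field R s)^o |
       continuous_polynomial n q /\ (polynomial_norm q <= 1%:E)%E]])%E.

(* Propositional form of [exists d, Vector.axiom d V]. *)
Definition finite_dimensional (K : numFieldType) (V : lmodType K) : Prop :=
  exists d : nat, exists2 v2r : V -> 'rV[K]_d, linear v2r & bijective v2r.

(* Main.v *)
Require Import Defs.
From HB Require Import structures.
From mathcomp Require Import all_boot all_order all_algebra.
From mathcomp Require Import perm complex ring lra.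
From mathcomp Require Import all_classical all_reals all_analysis.
Import Order.TTheory GRing.Theory Num.Theory numFieldNormedType.Exports.

(** If Y is finite dimensional, its coordinate functionals are bounded
    ([coordinate_bounded], by equivalence of norms), so composing P with them
    gives finitely many scalar polynomials, bounded on the unit ball, whose
    values control the norm of every combination of values of P; comparing
    finite sums of p-th powers gives the constant.

    Conversely, choose by Hahn-Banach a bounded functional phi and a vector a
    with phi a = 1, and apply the hypothesis to P x = phi x ^ (n - 1) *: x.  Let
    nodes t_i and weights l_i extract the coefficient of degree one of every
    polynomial of degree at most n.  For u in the kernel of phi the curve
    t |-> P (a + t u) = a + t u is affine, so the combination with weights l_i of
    the values P (a + t_i u) is u itself.  For a scalar polynomial q of norm at
    most 1 the same combination of q is the directional derivative of q at a: a
    linear functional of u, bounded by a constant B that does not depend on q.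
    Hence on the kernel of phi the inequality says that the identity is
    p-summing.

    A space whose identity is p-summing is finite dimensional.  By the
    Dvoretzky-Rogers lemma ([dvoretzky_rogers]) every normed space of dimension
    2m contains m vectors of norm at least 2/5 with

      || sum_i c_i v_i || <= (sum_i c_i^2)^(1/2)    for all real c_i,

    which forces sum_i |psi v_i|^2 to stay bounded when psi ranges over the
    functionals of norm at most B.  Since b^p <= d + b^2 / d for 0 <= b <= 1 and
    every d > 0, the p-th power sums of the psi v_i are at most a fixed small
    multiple of m plus a constant, whereas those of the norms are at least
    (2/5)^p m; so m is bounded ([summing_dim_bounded]).

    The Dvoretzky-Rogers lemma is proved by taking a linear contraction u from
    the Euclidean space into the given norm whose determinant is more than half
    of the supremum.  If u had norm at most 2/5 on a subspace of dimension more
    than m, doubling u on that subspace and dividing by 7/5 would give a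
    contraction of too large a determinant, because 2^(m+1) >= 2 (7/5)^(2m).
    Orthonormal vectors with images of norm at least 2/5 are thus found one at a
    time, and Householder reflections move them to coordinate vectors.  Complex
    spaces are treated through their underlying real spaces. *)

Set Implicit Arguments.
Unset Strict Implicit.
Unset Printing Implicit Defensive.

Local Open Scope classical_set_scope.
Local Open Scope ring_scope.

(** * Linear maps given by the predicate [linear] *)

Section LinearMaps.
Variables (K : numFieldType) (X Y : lmodType K) (f : X -> Y).
Hypothesis lf : linear f.

Lemma linear_mapD x y : f (x + y) = f x + f y.
Proof. by have := lf 1 x y; rewrite !scale1r. Qed.

Lemma linear_map0 : f 0 = 0.
Proof. by apply: (@addrI _ (f 0)); rewrite -linear_mapD !addr0. Qed.

Lemma linear_mapZ a x : f (a *: x) = a *: f x.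
Proof. by have := lf a x 0; rewrite linear_map0 !addr0. Qed.

Lemma linear_injective : (forall x, f x = 0 -> x = 0) -> injective f.
Proof.
move=> h x y xy; apply/eqP; rewrite -subr_eq0; apply/eqP/h.
by rewrite addrC -scaleN1r lf xy scaleN1r addNr.
Qed.

End LinearMaps.

(** * Norms on real vector spaces *)

(** Norms are plain functions here, because the same vector space has to carry
    several of them: the Euclidean norm and a norm pulled back from Y. *)
Record is_norm (R : realType) (V : lmodType R) (nu : V -> R) : Prop := IsNorm {
  norm_triangle : forall x y, nu (x + y) <= nu x + nu y;
  norm_scale : forall a x, nu (a *: x) = `|a| * nu x;
  norm_definite : forall x, nu x = 0 -> x = 0 }.

Section RealNorm.
Variables (R : realType) (V : lmodType R) (nu : V -> R).
Hypothesis nuP : is_norm nu.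

Lemma norm_at0 : nu 0 = 0.
Proof. by rewrite -(scale0r (0 : V)) (norm_scale nuP) normr0 mul0r. Qed.

Lemma norm_ge0 x : 0 <= nu x.
Proof.
have := norm_triangle nuP x (- x).
rewrite subrr norm_at0 -scaleN1r (norm_scale nuP) normrN normr1 mul1r; lra.
Qed.

Lemma norm_sum (I : Type) (r : seq I) (P : pred I) (F : I -> V) :
  nu (\sum_(i <- r | P i) F i) <= \sum_(i <- r | P i) nu (F i).
Proof.
elim/big_ind2: _ => [|x a y b xa yb|//]; first by rewrite norm_at0.
by apply: le_trans (norm_triangle nuP _ _) _; exact: lerD.
Qed.

Lemma norm_dist x y : `|nu x - nu y| <= nu (x - y).
Proof.
have h u v : nu u - nu v <= nu (u - v).
  by rewrite lerBlDr -{1}(subrK v u); exact: norm_triangle.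
rewrite ler_norml h andbT lerNl opprB.
rewrite (le_trans (h y x)) // -(opprB x y) -(scaleN1r (x - y)).
by rewrite (norm_scale nuP) normrN normr1 mul1r.
Qed.

End RealNorm.

Lemma norm_le_coord (R : realType) (n : nat) (nu : 'rV[R]_n -> R)
    (nuP : is_norm nu) (x : 'rV[R]_n) :
  nu x <= \sum_i `|x 0 i| * nu (delta_mx 0 i).
Proof.
rewrite {1}(row_sum_delta x); apply: le_trans (norm_sum nuP _ _ _) _.
by apply: ler_sum => i _; rewrite (norm_scale nuP).
Qed.

(** Equivalence of norms: [nu] attains a positive minimum on the unit sphere of
    the sup norm, which is compact. *)
Lemma coord_le_norm (R : realType) (n : nat) (nu : 'rV[R]_n -> R) :
  is_norm nu -> exists2 c : R, 0 < c & forall (x : 'rV[R]_n) i, `|x 0 i| <= c * nu x.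
Proof.
case: n nu => [|n] nu nuP; first by exists 1 => // x [].
have coordle (x : 'rV[R]_n.+1) i : `|x 0 i| <= `|x|.
  rewrite [leRHS]/Num.norm /= mx_normrE.
  by apply/bigmax_geP; right => /=; exists (0, i).
pose C := \sum_i nu (delta_mx 0 i : 'rV[R]_n.+1).
have nuC (x : 'rV[R]_n.+1) : nu x <= C * `|x|.
  apply: le_trans (norm_le_coord nuP x) _; rewrite mulr_suml.
  by apply: ler_sum => i _; rewrite mulrC ler_wpM2l ?norm_ge0.
have C0 : 0 <= C by apply: sumr_ge0 => i _; exact: norm_ge0.
pose S := [set x : 'rV[R]_n.+1 | `|x| = 1].
have cS : compact S.
  apply: bounded_closed_compact.
    by exists 1; split => // M M1 x /= ->; exact: ltW.
  rewrite (_ : S = (fun x => `|x|) @^-1` [set 1]); last by apply/seteqP; split.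
  by apply: closed_comp; [move=> x _; exact: norm_continuous|exact: closed_eq].
have S0 : S !=set0.
  exists (const_mx 1); rewrite /S /= [LHS]/Num.norm /= mx_normrE.
  apply/eqP; rewrite eq_le; apply/andP; split.
    by apply/bigmax_leP; split => // i _; rewrite mxE normr1.
  by apply/bigmax_geP; right; exists (0, 0) => //; rewrite mxE normr1.
have cnu : continuous nu.
  move=> x; apply/(@cvgrPdist_lt _ _ _ (nbhs x)) => e e0; near=> y.
  apply: le_lt_trans (norm_dist nuP _ _) _.
  apply: le_lt_trans (nuC _) _.
  have -> : e = (C + 1) * (e / (C + 1)) by rewrite mulrC divfK // gt_eqF //; lra.
  apply: (@le_lt_trans _ _ ((C + 1) * `|x - y|)).
    by rewrite ler_wpM2r //; lra.
  rewrite ltr_pM2l; last lra.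
  by near: y; apply: cvgr_dist_lt => //; rewrite divr_gt0 //; lra.
have [c cin cmin] := EVT_min_rV S0 cS (continuous_subspaceT cnu).
have Sc : `|c| = 1 by move: cin; rewrite inE.
have nuc : 0 < nu c.
  rewrite lt_neqAle norm_ge0 // andbT eq_sym; apply/eqP => /(norm_definite nuP) c0.
  by move: Sc; rewrite c0 normr0 => /eqP; rewrite eq_sym oner_eq0.
exists (nu c)^-1; first by rewrite invr_gt0.
move=> x i; rewrite mulrC ler_pdivlMr //.
have [->|x0] := eqVneq x 0; first by rewrite mxE normr0 mul0r norm_ge0.
apply: (@le_trans _ _ (`|x| * nu c)); first by rewrite ler_wpM2r ?norm_ge0.
have nx : 0 < `|x| by rewrite normr_gt0.
have := cmin (`|x|^-1 *: x); rewrite inE /S /= normrZ normfV normr_id mulVf ?gt_eqF //.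
move=> /(_ erefl); rewrite (norm_scale nuP) normfV normr_id.
by rewrite ler_pdivlMl.
Unshelve. all: by end_near. Qed.

(** * Euclidean norm and Householder reflections *)

Section EuclideanNorm.
Variables (R : realType) (n : nat).
Implicit Types x y w : 'rV[R]_n.

(** Squared Euclidean norm and Euclidean norm of a row vector. *)
Definition sqnorm x : R := (x *m x^T) 0 0.
Definition enorm x : R := Num.sqrt (sqnorm x).

Lemma sqnormE x : sqnorm x = \sum_i x 0 i ^+ 2.
Proof. by rewrite /sqnorm mxE; apply: eq_bigr => i _; rewrite mxE expr2. Qed.

Lemma sqnorm_ge0 x : 0 <= sqnorm x.
Proof. by rewrite sqnormE; apply: sumr_ge0 => i _; exact: sqr_ge0. Qed.

Lemma sqnorm_eq0 x : sqnorm x = 0 -> x = 0.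
Proof.
rewrite sqnormE => /eqP; rewrite psumr_eq0 => [|i _]; last exact: sqr_ge0.
move=> /allP h; apply/rowP => i; rewrite mxE.
by have := h i (mem_index_enum _); rewrite sqrf_eq0 => /eqP.
Qed.

Lemma enorm_ge0 x : 0 <= enorm x.
Proof. exact: sqrtr_ge0. Qed.

Lemma sqr_enorm x : enorm x ^+ 2 = sqnorm x.
Proof. by rewrite sqr_sqrtr // sqnorm_ge0. Qed.

Lemma coord_le_enorm x i : `|x 0 i| <= enorm x.
Proof.
rewrite -sqrtr_sqr ler_sqrt ?sqnorm_ge0 // sqnormE (bigD1 i) //= lerDl.
by apply: sumr_ge0 => j _; exact: sqr_ge0.
Qed.

Lemma enormZ a x : enorm (a *: x) = `|a| * enorm x.
Proof.
rewrite /enorm /sqnorm linearZ /= -scalemxAl -scalemxAr !mxE mulrA -expr2.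
by rewrite sqrtrM ?sqr_ge0 // sqrtr_sqr.
Qed.

Lemma enorm_delta i : enorm (delta_mx 0 i) = 1.
Proof.
rewrite /enorm sqnormE (bigD1 i) //= mxE !eqxx expr1n big1 ?addr0 ?sqrtr1 //.
by move=> j ji; rewrite mxE (negPf ji) andbF expr0n.
Qed.

(** Householder reflection in the hyperplane orthogonal to [w], acting on row
    vectors from the right; it is the identity when [w = 0], as [0^-1 = 0]. *)
Definition reflection (w : 'rV[R]_n) : 'M[R]_n :=
  1%:M - (2 / sqnorm w) *: (w^T *m w).

Lemma mul_reflection w x :
  x *m reflection w = x - (2 / sqnorm w * (x *m w^T) 0 0) *: w.
Proof.
rewrite /reflection mulmxBr mulmx1 -scalemxAr mulmxA.
by rewrite {1}(mx11_scalar (x *m w^T)) mul_scalar_mx scalerA.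
Qed.

Lemma reflection_tr w : (reflection w)^T = reflection w.
Proof.
by rewrite /reflection linearB /= trmx1 linearZ /= trmx_mul trmxK.
Qed.

Lemma reflectionK w : reflection w *m reflection w = 1%:M.
Proof.
have [w0|w0] := eqVneq (sqnorm w) 0.
  by rewrite /reflection w0 invr0 mulr0 scale0r subr0 mulmx1.
have refl2 x : x *m reflection w *m reflection w = x.
  set b := (x *m w^T) 0 0.
  have hb : (x *m reflection w *m w^T) 0 0 = - b.
    have subZ (p q : 'M[R]_1) a : (p - a *: q) 0 0 = p 0 0 - a * q 0 0.
      by rewrite !mxE.
    by rewrite mul_reflection mulmxBl -scalemxAl subZ -/(sqnorm w) -/b; field.
  by rewrite mul_reflection hb mul_reflection -/b mulrN scaleNr opprK subrK.
apply/row_matrixP => i; rewrite row_mul.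
by rewrite -{1}(mul1mx (reflection w)) row_mul refl2.
Qed.

Lemma sqnorm_reflection w x : sqnorm (x *m reflection w) = sqnorm x.
Proof.
by rewrite /sqnorm trmx_mul reflection_tr mulmxA -(mulmxA x) reflectionK mulmx1.
Qed.

Lemma det_reflection w : `|\det (reflection w)| = 1.
Proof.
apply/eqP; rewrite -sqrp_eq1 // -normrX expr2 -det_mulmx reflectionK det1.
by rewrite normr1.
Qed.

Lemma reflection_fixed w i :
  w 0 i = 0 -> (delta_mx 0 i : 'rV_n) *m reflection w = delta_mx 0 i.
Proof.
move=> w0; rewrite mul_reflection -rowE !mxE w0 mulr0 scale0r subr0 //.
Qed.

(** The reflection in the bisecting hyperplane of two unit vectors maps one to
    the other. *)
Lemma reflection_swap i x : sqnorm x = 1 ->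
  (delta_mx 0 i : 'rV_n) *m reflection (delta_mx 0 i - x) = x.
Proof.
move=> x1; set e : 'rV[R]_n := delta_mx 0 i; set w := e - x.
have ee : (e *m e^T) 0 0 = 1 by rewrite -rowE !mxE !eqxx.
have ex : (e *m x^T) 0 0 = x 0 i by rewrite -rowE !mxE.
have xe : (x *m e^T) 0 0 = x 0 i.
  by rewrite -[RHS]ex -[x in LHS]trmxK -trmx_mul mxE.
have ew : (e *m w^T) 0 0 = 1 - x 0 i.
  by rewrite /w linearB /= mulmxBr !mxE -ee -ex !mxE.
have ww : sqnorm w = 2 * (1 - x 0 i).
  have sub11 (p q : 'M[R]_1) : (p - q) 0 0 = p 0 0 - q 0 0 by rewrite !mxE.
  rewrite /sqnorm {1}/w mulmxBl sub11 ew.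
  rewrite /w linearB /= mulmxBr sub11 xe -/(sqnorm x) x1; ring.
rewrite mul_reflection.
have [w0|w0] := eqVneq (sqnorm w) 0.
  by have w00 := sqnorm_eq0 w0; rewrite w00 scaler0 subr0; exact: subr0_eq w00.
have -> : 2 / sqnorm w * (e *m w^T) 0 0 = 1.
  rewrite ew ww; rewrite ww mulf_eq0 negb_or in w0; field.
  by case/andP: w0.
by rewrite scale1r /w opprB addrCA subrr addr0.
Qed.

End EuclideanNorm.
(** * The Dvoretzky-Rogers lemma *)

Section DvoretzkyRogers.
Variables (R : realType) (n : nat) (nu : 'rV[R]_n -> R).
Hypothesis nuP : is_norm nu.
Implicit Types (u : 'M[R]_n) (x : 'rV[R]_n).

(** [u], read as the map x |-> x *m u, has norm at most 1 from the Euclidean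
    norm to [nu]. *)
Definition contraction u := forall x, nu (x *m u) <= enorm x.

Lemma contraction_det_bounded :
  exists B : R, forall u, contraction u -> `|\det u| <= B.
Proof.
have [c c0 hc] := coord_le_norm nuP.
pose b (s : 'S_n) := \prod_(i < n) c.
exists (\sum_s b s) => u cu.
rewrite /determinant; apply: le_trans (ler_norm_sum _ _ _) _.
apply: ler_sum => s _; rewrite normrM normrX normrN normr1 expr1n mul1r.
rewrite normr_prod; apply: ler_prod => i _; rewrite normr_ge0 /=.
have := hc (row i u) (s i); rewrite mxE => /le_trans -> //.
rewrite -[leRHS]mulr1 ler_pM2l // rowE -(enorm_delta R i); exact: cu.
Qed.

Lemma contraction_det_gt0 : exists2 u, contraction u & 0 < `|\det u|.
Proof.
pose C := 1 + \sum_i nu (delta_mx 0 i).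
have C0 : 0 < C.
  by rewrite ltr_pwDl // sumr_ge0 // => i _; exact: norm_ge0.
exists (C^-1)%:M; last by rewrite det_scalar normrX exprn_gt0 // normr_gt0 invr_neq0 ?gt_eqF.
move=> x; rewrite mul_mx_scalar (norm_scale nuP) gtr0_norm ?invr_gt0 //.
rewrite mulrC ler_pdivrMr //; apply: le_trans (norm_le_coord nuP x) _.
rewrite mulrDr mulr1 mulr_sumr ler_wpDl ?enorm_ge0 //.
by apply: ler_sum => i _; rewrite ler_wpM2r ?norm_ge0 ?coord_le_enorm.
Qed.

(** The vector [x] vanishes on the coordinates in [A]. *)
Definition supported (A : {set 'I_n}) x := forall i, i \in A -> x 0 i = 0.

(** A unit vector [x] orthogonal to the coordinate vectors of [A] can be moved
    to a new coordinate vector by a reflection, which fixes the rows of [u]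
    indexed by [A] and preserves the absolute value of the determinant. *)
Lemma enlarge_rows u (t : R) (A : {set 'I_n}) i x :
  contraction u -> (forall j, j \in A -> t <= nu (row j u)) -> i \notin A ->
  supported A x -> enorm x = 1 -> t <= nu (x *m u) ->
  exists v, [/\ contraction v, `|\det v| = `|\det u| &
    forall j, j \in i |: A -> t <= nu (row j v)].
Proof.
move=> cu hA iA xA x1 tx.
have sx : sqnorm x = 1 by rewrite -sqr_enorm x1 expr1n.
pose w := delta_mx 0 i - x; exists (reflection w *m u); split.
- by move=> y; rewrite mulmxA (le_trans (cu _)) // /enorm sqnorm_reflection.
- by rewrite det_mulmx normrM det_reflection mul1r.
move=> j; rewrite rowE mulmxA in_setU1 => /orP[/eqP->|jA].
  by rewrite reflection_swap.
rewrite reflection_fixed -?rowE ?hA // /w !mxE xA // subr0 eqxx /=.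
by case: eqP => // ji; rewrite -ji jA in iA.
Qed.

(** Doubling [u] on the coordinates outside [A], where its norm is at most [t],
    gives a map of norm at most [1 + t]. *)
Lemma dilate u (t : R) (A : {set 'I_n}) : 0 <= t ->
  contraction u ->
  (forall x, supported A x -> nu (x *m u) <= t * enorm x) ->
  exists2 v, contraction v &
    `|\det v| * (1 + t) ^+ n = 2 ^+ (n - #|A|) * `|\det u|.
Proof.
move=> t0 cu hA.
pose d : 'rV[R]_n := \row_i (if i \in A then 1 else 2).
have t1 : 0 < 1 + t by lra.
exists ((1 + t)^-1 *: (diag_mx d *m u)).
  move=> x; rewrite -scalemxAr (norm_scale nuP) gtr0_norm ?invr_gt0 // ler_pdivrMl //.
  pose y : 'rV[R]_n := \row_i (if i \in A then 0 else x 0 i).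
  have -> : x *m (diag_mx d *m u) = x *m u + y *m u.
    rewrite mulmxA -mulmxDl; congr (_ *m _); rewrite mul_mx_diag.
    by apply/rowP => i; rewrite !mxE; case: ifP => _; ring.
  apply: le_trans (norm_triangle nuP _ _) _; rewrite mulrDl mul1r; apply: lerD => //.
  apply: le_trans (hA _ _) _; first by move=> i iA; rewrite mxE iA.
  apply: ler_wpM2l => //; rewrite ler_sqrt ?sqnorm_ge0 // !sqnormE.
  by apply: ler_sum => i _; rewrite mxE; case: ifP => // _; rewrite expr0n sqr_ge0.
rewrite detZ normrM normrX gtr0_norm ?invr_gt0 // mulrAC exprVn mulVf ?mul1r; last first.
  by rewrite expf_neq0 // gt_eqF.
rewrite det_mulmx normrM det_diag; congr (_ * _).
rewrite (bigID (mem A)) /= big1 => [|i iA]; last by rewrite mxE iA.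
rewrite mul1r (eq_bigr (fun=> 2)) => [|i /negPf iA]; last by rewrite mxE iA.
rewrite prodr_const normrX ger0_norm //; congr (_ ^+ _).
have := cardC (mem A); rewrite card_ord => /(congr1 (subn^~ #|A|)).
by rewrite addKn => <-; apply: eq_card => i; rewrite !inE.
Qed.

End DvoretzkyRogers.

(** Every norm on a space of dimension [2m] admits a Euclidean contraction with
    at least [m] rows of norm at least [2 / 5]. *)
Lemma dvoretzky_rogers (R : realType) (m : nat) (nu : 'rV[R]_(m.*2) -> R) :
  is_norm nu ->
  exists u : 'M[R]_(m.*2), exists A : {set 'I_(m.*2)},
  [/\ contraction nu u, (m <= #|A|)%N &
    forall i, i \in A -> 2 / 5 <= nu (row i u)].
Proof.
move=> nuP; set n := m.*2.
pose D : set R := [set `|\det u| | u in [set u : 'M[R]_n | contraction nu u]].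
have [B hB] := contraction_det_bounded nuP.
have [u0 cu0 du0] := contraction_det_gt0 nuP.
have Dsup : has_sup D.
  split; first by exists `|\det u0|; exists u0.
  by exists B => _ [u cu <-]; exact: hB.
have Dle u : contraction nu u -> `|\det u| <= sup D.
  by move=> cu; apply: ub_le_sup; [case: Dsup|exists u].
have S0 : 0 < sup D by apply: lt_le_trans du0 _; exact: Dle.
(* Rows of norm at least 2 / 5 are produced one at a time. *)
suff : forall r, (r <= m)%N -> exists u : 'M[R]_n, exists A : {set 'I_n},
    [/\ contraction nu u, sup D / 2 < `|\det u|, (r <= #|A|)%N &
     forall i, i \in A -> 2 / 5 <= nu (row i u)].
  by move=> /(_ m (leqnn m))[u [A [cu _ mA hA]]]; exists u, A.
elim=> [_|r IH rm].
  have S2 : 0 < sup D / 2 by lra.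
  have [_ [u cu <-]] := sup_adherent S2 Dsup.
  rewrite (_ : sup D - sup D / 2 = sup D / 2); last by field.
  by move=> du; exists u, finset.set0; split => // i; rewrite inE.
have [u [A [cu du rA hA]]] := IH (ltnW rm).
have [?|Ar] := leqP r.+1 #|A|; first by exists u, A.
have {rA Ar} cA : #|A| = r by apply/eqP; rewrite eqn_leq rA andbT -ltnS.
have [[x [xA x1 tx]]|no] := pselect (exists x : 'rV[R]_n,
    [/\ supported A x, enorm x = 1 & 2 / 5 <= nu (x *m u)]).
  have [i iA] : exists i, i \notin A.
    apply/existsP; rewrite -negb_forall; apply/negP => /forallP AT.
    have : #|A| = n by rewrite -[RHS]card_ord; apply: eq_card => i; rewrite AT.
    rewrite cA /n => rn; move: rm; rewrite rn -addnn ltnNge leq_addr //.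
  have [v [cv dv hv]] := enlarge_rows cu hA iA xA x1 tx.
  by exists v, (i |: A); split; rewrite ?dv // cardsU1 iA cA.
(* Otherwise u has norm at most 2 / 5 on the span of the n - r remaining
   coordinate vectors, and dilating it there contradicts the choice of u. *)
have t0 : 0 <= 2 / 5 :> R by lra.
have small x : supported A x -> nu (x *m u) <= 2 / 5 * enorm x.
  move=> xA; have [x0|x0] := eqVneq (enorm x) 0.
    by rewrite x0 mulr0 -x0; exact: cu.
  have ex : 0 < enorm x by rewrite lt_neqAle eq_sym x0 enorm_ge0.
  rewrite -ler_pdivrMr // leNgt; apply/negP => lt; apply: no.
  exists ((enorm x)^-1 *: x); split.
  - by move=> i iA; rewrite mxE xA // mulr0.
  - by rewrite enormZ gtr0_norm ?invr_gt0 // mulVf.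
  - by rewrite -scalemxAl (norm_scale nuP) gtr0_norm ?invr_gt0 // [leRHS]mulrC ltW.
have [v cv] := dilate nuP t0 cu small.
rewrite cA => dv; exfalso.
have : `|\det v| * (1 + 2 / 5) ^+ n <= sup D * 2 ^+ m.
  apply: ler_pM => //; last first.
    rewrite /n -mul2n exprM lerXn2r // ?nnegrE; lra.
  exact: Dle.
rewrite dv leNgt => /negP; apply.
have : 2 ^+ m.+1 <= 2 ^+ (n - r) :> R.
  rewrite ler_eXn2l ?ltr1n // leq_subRL /n -addnn.
    by rewrite addnS -addSn leq_add2r.
  by rewrite (leq_trans (ltnW rm)) // leq_addr.
have p0 : 0 < 2 ^+ m :> R by rewrite exprn_gt0.
rewrite exprS => pm; apply: (@lt_le_trans _ _ (2 * 2 ^+ m * `|\det u|)).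
  by rewrite -mulrA mulrCA [ltLHS]mulrC ltr_pM2l //; lra.
by rewrite ler_wpM2r.
Qed.

(** The rows of a contraction are weakly square summable: evaluate [f] at their
    combination with coefficients [f (row i u)]. *)
Lemma contraction_weak_l2 (R : realType) (n : nat) (nu : 'rV[R]_n -> R)
    (u : 'M[R]_n) (f : 'rV[R]_n -> R) (B : R) :
  is_norm nu -> contraction nu u -> 0 <= B -> scalar f ->
  (forall x, f x <= B * nu x) -> \sum_i f (row i u) ^+ 2 <= B ^+ 2.
Proof.
move=> nuP cu B0 lf hf.
pose F : {scalar 'rV[R]_n} := HB.pack f (GRing.isLinear.Build _ _ _ _ f lf).
pose x : 'rV[R]_n := \row_i f (row i u).
have sx : sqnorm x = \sum_i f (row i u) ^+ 2.
  by rewrite sqnormE; apply: eq_bigr => i _; rewrite mxE.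
have fx : f (x *m u) = sqnorm x.
  rewrite mulmx_sum_row -[f]/(F : _ -> _) linear_sum sx; apply: eq_bigr => i _.
  by rewrite linearZ /= mxE expr2.
rewrite -sx -sqr_enorm lerXn2r ?nnegrE ?enorm_ge0 //.
have [->//|x0] := eqVneq (enorm x) 0.
have ex : 0 < enorm x by rewrite lt_neqAle eq_sym x0 enorm_ge0.
rewrite -(ler_pM2r ex) -expr2 sqr_enorm -fx (le_trans (hf _)) //.
by rewrite ler_wpM2l.
Qed.
(** * Real and complex scalars *)

Section Scalars.
Variables (R : realType) (s : scalar_kind).

(** The embedding of the reals into the scalar field. *)
Definition scalar_of_real : R -> scalar_field R s :=
  match s return R -> scalar_field R s with
  | RealScalars => fun x => x
  | ComplexScalars => fun x => real_complex R x
  end.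

(** Imaginary part; it is 0 when the scalars are real. *)
Definition scalar_im : scalar_field R s -> R :=
  match s return scalar_field R s -> R with
  | RealScalars => fun=> 0
  | ComplexScalars => fun z => complex.Im z
  end.

Lemma scalar_of_real_is_additive : zmod_morphism scalar_of_real.
Proof.
by rewrite /scalar_of_real; case: s => x y //; exact: (rmorphB (real_complex R)).
Qed.

Lemma scalar_of_real_is_multiplicative : monoid_morphism scalar_of_real.
Proof.
rewrite /scalar_of_real; case: s; split => // x y.
exact: (rmorphM (real_complex R)).
Qed.

HB.instance Definition _ :=
  GRing.isZmodMorphism.Build R (scalar_field R s) scalar_of_real
    scalar_of_real_is_additive.
HB.instance Definition _ :=
  GRing.isMonoidMorphism.Build R (scalar_field R s) scalar_of_real
    scalar_of_real_is_multiplicative.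

Lemma ler_scalar_of_real x y : (scalar_of_real x <= scalar_of_real y) = (x <= y).
Proof. by rewrite /scalar_of_real; case: s => //; exact: lecR. Qed.

Lemma scalar_of_realK : cancel scalar_of_real (@scalar_re R s).
Proof. by rewrite /scalar_of_real; case: s. Qed.

Lemma scalar_re_eq (z : scalar_field R s) : 0 <= z -> scalar_of_real (scalar_re z) = z.
Proof.
rewrite /scalar_of_real; case: s z => //= z z0.
by apply: RRe_real; exact: ger0_real.
Qed.

Lemma scalar_re_scalar (r : R) (z w : scalar_field R s) :
  scalar_re (scalar_of_real r * z + w) = r * scalar_re z + scalar_re w.
Proof.
rewrite /scalar_of_real; case: s z w => //= -[a b] [c d] /=.
by rewrite mul0r subr0.
Qed.

Lemma scalar_im_scalar (r : R) (z w : scalar_field R s) :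
  scalar_im (scalar_of_real r * z + w) = r * scalar_im z + scalar_im w.
Proof.
rewrite /scalar_of_real /scalar_im; case: s z w => [z w|[a b] [c d]] /=.
  by rewrite mulr0 addr0.
by rewrite mul0r addr0.
Qed.

End Scalars.

Section RNorm.
Variables (R : realType) (s : scalar_kind).
Local Notation K := (scalar_field R s).
Local Notation emb := (@scalar_of_real R s).
Variable V : normedModType K.
Implicit Types v w : V.

Lemma rnormE v : emb (rnorm v) = `|v|.
Proof. by rewrite scalar_re_eq. Qed.

Lemma rnorm_ge0 v : 0 <= rnorm v.
Proof. by rewrite -(@ler_scalar_of_real R s) rnormE rmorph0. Qed.

Lemma rnorm_triangle v w : rnorm (v + w) <= rnorm v + rnorm w.
Proof. by rewrite -(@ler_scalar_of_real R s) rmorphD /= !rnormE ler_normD. Qed.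

Lemma rnorm_eq0 v : rnorm v = 0 -> v = 0.
Proof. by move=> v0; apply/normr0_eq0; rewrite -rnormE v0 rmorph0. Qed.

Lemma rnormZ (c : K) v : rnorm (c *: v) = rnorm (c : K^o) * rnorm v.
Proof.
apply: (can_inj (@scalar_of_realK R s)); rewrite rmorphM /=.
have -> : emb (rnorm (c : K^o)) = `|c| by exact: scalar_re_eq.
by rewrite !rnormE; exact: normrZ.
Qed.

Lemma rnorm_emb (r : R) : rnorm (emb r : K^o) = `|r|.
Proof.
have pos (t : R) : 0 <= t -> rnorm (emb t : K^o) = t.
  move=> t0; rewrite /rnorm (_ : `|_| = emb t) ?scalar_of_realK //.
  by apply: ger0_norm; rewrite -(rmorph0 emb) ler_scalar_of_real.
have [r0|r0] := leP 0 r; first by rewrite pos // ger0_norm.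
rewrite ltr0_norm // -[RHS]pos ?oppr_ge0 ?ltW // /rnorm; congr scalar_re.
by rewrite rmorphN normrN.
Qed.

End RNorm.

Lemma rnorm_scalar_le (R : realType) (s : scalar_kind) (z : (scalar_field R s)^o) :
  rnorm z <= `|scalar_re z| + `|scalar_im z|.
Proof.
rewrite /rnorm; case: s z => [z|z]; first by rewrite /= normr0 addr0.
rewrite -lecR [leLHS]RRe_real ?normr_real //.
change (`|z : R[i]%C| <= (`|complex.Re z| + `|complex.Im z|)%:C%C).
rewrite normc_def lecR -[leRHS]ger0_norm ?addr_ge0 // -[leRHS]sqrtr_sqr.
rewrite ler_wsqrtr //.
rewrite sqrrD !real_normK ?num_real // -addrA lerD2l lerDr.
by rewrite mulrn_wge0 // mulr_ge0.
Qed.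

Lemma scalar_re_im_le (R : realType) (s : scalar_kind) (z : (scalar_field R s)^o) :
  `|scalar_re z| <= rnorm z /\ `|scalar_im z| <= rnorm z.
Proof.
rewrite /rnorm; case: s z => [z|z]; first by rewrite /= normr0.
suff h : complex.Re (`|z : R[i]%C|) = Num.sqrt (complex.Re z ^+ 2 + complex.Im z ^+ 2).
  change (`|complex.Re z| <= complex.Re (`|z : R[i]%C|) /\
    `|complex.Im z| <= complex.Re (`|z : R[i]%C|)).
  by rewrite h -!sqrtr_sqr; split; apply: ler_wsqrtr; rewrite ?lerDl ?lerDr sqr_ge0.
by rewrite normc_def.
Qed.

(** The real vector space underlying a vector space over the scalar field: the
    same additive group, with scaling through [scalar_of_real]. *)
Definition realification (R : realType) (s : scalar_kind)
  (V : lmodType (scalar_field R s)) : Type := V.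

Section Realification.
Variables (R : realType) (s : scalar_kind) (V : lmodType (scalar_field R s)).
HB.instance Definition _ := GRing.Zmodule.copy (realification V) V.

Let scale (r : R) (v : realification V) : realification V :=
  scalar_of_real s r *: (v : V).

Let scaleA a b v : scale a (scale b v) = scale (a * b) v.
Proof. by rewrite /scale scalerA rmorphM. Qed.

Let scale1 : left_id 1 scale.
Proof. by move=> v; rewrite /scale rmorph1 scale1r. Qed.

Let scaleDr : right_distributive scale +%R.
Proof. by move=> r v w; rewrite /scale scalerDr. Qed.

Let scaleDl v : {morph scale^~ v : a b / a + b}.
Proof. by move=> a b; rewrite /scale rmorphD scalerDl. Qed.

HB.instance Definition _ := GRing.Zmodule_isLmodule.Build R (realification V)
  scaleA scale1 scaleDr scaleDl.

Lemma realification_scaleE (r : R) (v : realification V) :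
  r *: v = scalar_of_real s r *: (v : V).
Proof. by []. Qed.

End Realification.

Lemma rnorm_is_norm (R : realType) (s : scalar_kind)
    (V : normedModType (scalar_field R s)) :
  is_norm (@rnorm R s V : realification V -> R).
Proof.
split; [exact: rnorm_triangle| |exact: rnorm_eq0].
by move=> a x; rewrite realification_scaleE rnormZ rnorm_emb.
Qed.

(** * The Hahn-Banach theorem *)

Section HahnBanach.
Variables (R : realType) (V : lmodType R).
Implicit Types (p q : V -> R) (x y : V).

(** Only an inequality is asked for positive scaling factors: applied to the
    factor and to its inverse it gives equality ([sublinearZ]). *)
Definition sublinear p :=
  (forall x y, p (x + y) <= p x + p y) /\
  (forall t x, 0 < t -> p (t *: x) <= t * p x).

Lemma sublinear0 p : sublinear p -> p 0 = 0.
Proof.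
move=> [_ pZ]; have := pZ 2 0 (ltr0Sn _ _); have := pZ 2^-1 0.
by rewrite !scaler0 invr_gt0 => /(_ (ltr0Sn _ _)); lra.
Qed.

Lemma sublinearZ p t x : sublinear p -> 0 <= t -> p (t *: x) = t * p x.
Proof.
move=> sp; rewrite le_eqVlt => /predU1P[<-|t0].
  by rewrite scale0r mul0r sublinear0.
apply/eqP; rewrite eq_le sp.2 //= -ler_pdivlMl //.
have := sp.2 t^-1 (t *: x); rewrite scalerA mulVf ?gt_eqF // scale1r.
by apply; rewrite invr_gt0.
Qed.

Lemma sublinear_opp p x : sublinear p -> - p (- x) <= p x.
Proof.
by move=> sp; have := sp.1 x (- x); rewrite subrr sublinear0 //; lra.
Qed.

(** The sublinear functional below [p] obtained by letting [p] decrease as much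
    as possible along the ray of [y]; at [- y] it is at most [- p y].  The infimum is finite
    by [tilt_has_lbound]. *)
Definition tilt p y x : R :=
  inf [set p (x + t *: y) - t * p y | t in [set t : R | 0 <= t]].

Section Tilt.
Variables (p : V -> R) (y : V).
Hypothesis sp : sublinear p.

Lemma tilt_has_lbound x :
  has_lbound [set p (x + t *: y) - t * p y | t in [set t : R | 0 <= t]].
Proof.
exists (- p (- x)) => _ [t t0 <-].
have := sp.1 (x + t *: y) (- x); rewrite addrAC subrr add0r sublinearZ //; lra.
Qed.

Lemma tilt_le x (t : R) : 0 <= t -> tilt p y x <= p (x + t *: y) - t * p y.
Proof. by move=> t0; apply: ge_inf; [exact: tilt_has_lbound|exists t]. Qed.

Lemma le_tilt x (b : R) :
  (forall t : R, 0 <= t -> b <= p (x + t *: y) - t * p y) -> b <= tilt p y x.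
Proof.
move=> h; apply: lb_le_inf; last by move=> _ [t t0 <-]; exact: h.
by exists (p (x + 0 *: y) - 0 * p y); exists 0 => //=.
Qed.

Lemma tilt_sublinear : sublinear (tilt p y).
Proof.
split=> [x x'|r x r0].
  rewrite -lerBlDr; apply: le_tilt => t t0; rewrite lerBlDr [leRHS]addrC -lerBlDr.
  apply: le_tilt => t' t'0; rewrite lerBlDr.
  apply: le_trans (tilt_le _ (addr_ge0 t0 t'0)) _.
  have -> : x + x' + (t + t') *: y = (x + t *: y) + (x' + t' *: y).
    by rewrite scalerDl addrACA.
  by have := sp.1 (x + t *: y) (x' + t' *: y); lra.
rewrite mulrC -ler_pdivrMr //; apply: le_tilt => t t0.
rewrite ler_pdivrMr //; apply: le_trans (tilt_le _ (mulr_ge0 (ltW r0) t0)) _.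
rewrite -scalerA -scalerDr sublinearZ ?(ltW r0) //.
by rewrite le_eqVlt; apply/orP; left; apply/eqP; ring.
Qed.

Lemma tilt_le_id x : tilt p y x <= p x.
Proof. by apply: le_trans (tilt_le x (lexx 0)) _; rewrite scale0r addr0 mul0r subr0. Qed.

Lemma tilt_opp : tilt p y (- y) <= - p y.
Proof.
apply: le_trans (tilt_le _ ler01) _.
by rewrite scale1r addNr sublinear0 // mul1r sub0r.
Qed.

End Tilt.

(** Zorn's lemma: the infimum of a chain of sublinear functionals below [p] is
    again sublinear, and is finite since it is bounded below by [- p (- x)]. *)
Lemma minimal_sublinear p : sublinear p ->
  exists q, [/\ sublinear q, forall x, q x <= p x &
    forall r, sublinear r -> (forall x, r x <= q x) -> r = q].
Proof.
move=> sp.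
pose T := {q | sublinear q /\ forall x, q x <= p x}.
pose below (q r : T) := `[< forall x, sval r x <= sval q x >].
have [||||[q [sq qp]] qmin] := @Zorn T below.
- by move=> q; apply/asboolP.
- move=> q r t /asboolP qr /asboolP rt; apply/asboolP => x.
  exact: le_trans (rt x) (qr x).
- move=> [q Pq] [r Pr] /asboolP /= qr /asboolP /= rq.
  by apply/eq_exist/funext => x; apply/eqP; rewrite eq_le qr rq.
- move=> A totA; have [[q0 Aq0]|A0] := pselect (A !=set0); last first.
    by exists (exist _ p (conj sp (fun x => lexx _))) => q Aq; case: A0; exists q.
  pose E x := [set sval q x | q in A].
  have lbE x : has_lbound (E x).
    exists (- p (- x)) => _ [q Aq <-]; have [sq qp] := svalP q.
    by apply: le_trans (sublinear_opp x sq); rewrite lerN2.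
  have infE (q : T) x : A q -> inf (E x) <= sval q x.
    by move=> Aq; apply: ge_inf => //; exists q.
  have leE x (b : R) : (forall q : T, A q -> b <= sval q x) -> b <= inf (E x).
    move=> h; apply: lb_le_inf; first by exists (sval q0 x); exists q0.
    by move=> _ [q Aq <-]; exact: h.
  have sE : sublinear (fun x => inf (E x)).
    split=> [x y|t x t0].
      rewrite -lerBlDr; apply/leE => q Aq; rewrite lerBlDr [leRHS]addrC -lerBlDr.
      apply/leE => r Ar; rewrite lerBlDr.
      have [/asboolP rq|/asboolP qr] := totA q r Aq Ar.
        apply: le_trans (infE _ _ Ar) _; apply: le_trans ((svalP r).1.1 _ _) _.
        by rewrite addrC lerD2l.
      apply: le_trans (infE _ _ Aq) _; apply: le_trans ((svalP q).1.1 _ _) _.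
      by rewrite addrC lerD2r.
    rewrite mulrC -ler_pdivrMr //; apply/leE => q Aq; rewrite ler_pdivrMr //.
    by apply: le_trans (infE _ _ Aq) _; rewrite mulrC; exact: (svalP q).1.2.
  have Ep x : inf (E x) <= p x.
    by apply: le_trans (infE _ _ Aq0) _; exact: (svalP q0).2.
  exists (exist _ (fun x => inf (E x)) (conj sE Ep) : T) => q Aq.
  by apply/asboolP => x; exact: infE.
exists q; split => // r sr rq.
have rp x : r x <= p x := le_trans (rq x) (qp x).
have := qmin (exist _ r (conj sr rp)) => /(_ (introT (asboolP _) rq)).
by move=> /(congr1 sval).
Qed.

(** A minimal sublinear functional coincides with all its tilts, hence is odd,
    and an odd sublinear functional is linear. *)
Lemma minimal_sublinear_scalar q : sublinear q ->
  (forall r, sublinear r -> (forall x, r x <= q x) -> r = q) -> scalar q.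
Proof.
move=> sq qmin.
have qN x : q (- x) = - q x.
  apply/eqP; rewrite eq_le; apply/andP; split.
    have {1}<- := qmin _ (tilt_sublinear x sq) (tilt_le_id x sq).
    exact: tilt_opp.
  by have := sublinear_opp x sq; lra.
have qD x y : q (x + y) = q x + q y.
  apply/eqP; rewrite eq_le sq.1 /=.
  by have := sq.1 (x + y) (- y); rewrite addrK qN; lra.
move=> a x y; rewrite qD; congr (_ + _).
have [a0|a0] := leP 0 a; first exact: sublinearZ.
rewrite -[in LHS](opprK a) scaleNr qN sublinearZ ?oppr_ge0 ?(ltW a0) //.
by rewrite mulNr opprK.
Qed.

End HahnBanach.

(** Hahn-Banach.  Starting from the tilt of [nu] along [a] ensures that the
    minimal functional takes at [- a] a value at most [- nu a]. *)
Lemma norming_functional (R : realType) (V : lmodType R) (nu : V -> R) (a : V) :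
  is_norm nu ->
  exists f : V -> R, [/\ scalar f, forall x, f x <= nu x & f a = nu a].
Proof.
move=> nuP.
have snu : sublinear nu.
  split; first exact: norm_triangle.
  by move=> t x t0; rewrite (norm_scale nuP) gtr0_norm.
have [f [sf fle fmin]] := minimal_sublinear (tilt_sublinear a snu).
have lf := minimal_sublinear_scalar sf fmin.
have fnu x : f x <= nu x := le_trans (fle x) (tilt_le_id a snu x).
exists f; split => //; apply/eqP; rewrite eq_le fnu /=.
have := le_trans (fle (- a)) (tilt_opp a snu).
by have := sublinear_opp a sf; lra.
Qed.

(** * Functionals over the scalar field *)

(** Over the complex numbers a real functional [f] is the real part of
    [f x - i f (i x)]; the scalar [c] is then [i]. *)
Lemma scalar_complexification (R : realType) (s : scalar_kind)
    (V : lmodType (scalar_field R s)) (f : realification V -> R) :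
  scalar f ->
  exists phi : V -> (scalar_field R s)^o, [/\ linear phi,
    forall x, scalar_re (phi x) = f x &
    exists2 c : scalar_field R s, rnorm (c : (scalar_field R s)^o) = 1 &
    forall x, `|scalar_im (phi x)| <= `|f (c *: x)| ].
Proof.
case: s V f => [V f lf|V f lf].
  exists f; split => //; exists 1 => [|x /=]; last by rewrite normr0.
  by rewrite /rnorm normr1.
have fD x y : f (x + y) = f x + f y.
  by have := lf 1 x y; rewrite scale1r mul1r.
have fZ (a : R) x : f ((a%:C)%C *: (x : V)) = a * f x.
  have f0 : f 0 = 0 by have := fD 0 0; rewrite addr0; lra.
  by have := lf a x 0; rewrite addr0 f0 addr0.
exists (fun x : V => Complex (f x) (- f ('i%C *: x))); split => //.
  move=> [a b] x y.
  have e : forall z : V, Complex a b *: z = (a%:C)%C *: z + (b%:C)%C *: ('i%C *: z).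
    move=> z; rewrite scalerA -scalerDl; congr (_ *: _).
    by apply/eqP; rewrite eq_complex /=; apply/andP; split; apply/eqP; ring.
  have ii (z : V) : 'i%C *: ('i%C *: z) = ((-1)%:C)%C *: z.
    rewrite scalerA; congr (_ *: _).
    by apply/eqP; rewrite eq_complex /=; apply/andP; split; apply/eqP; ring.
  apply/eqP; rewrite eq_complex /=; apply/andP; split; apply/eqP.
    by rewrite fD e fD !fZ; ring.
  have -> : 'i%C *: (Complex a b *: x + y) =
      (a%:C)%C *: ('i%C *: x) + (b%:C)%C *: ((-1)%:C%C *: x) + 'i%C *: y :> V.
    by rewrite scalerDr scalerA mulrC -scalerA e ii.
  by rewrite !fD !fZ; ring.
exists 'i%C; last by move=> x /=; rewrite normrN.
rewrite /rnorm -[`|_|]/(`|'i%C : R[i]%C|) normc_def /=.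
by rewrite expr0n expr1n add0r sqrtr1.
Qed.

Lemma scalarN (R : realType) (V : lmodType R) (f : V -> R) (x : V) :
  scalar f -> f (- x) = - f x.
Proof.
move=> lf; have f0 : f 0 = 0.
  by have := lf 1 0 0; rewrite scaler0 addr0 mul1r; lra.
by have := lf (-1) x 0; rewrite addr0 f0 addr0 scaleN1r mulN1r.
Qed.

(** Every nonzero vector is mapped to 1 by some bounded functional. *)
Lemma dual_functional (R : realType) (s : scalar_kind)
    (V : normedModType (scalar_field R s)) (a : V) : a != 0 ->
  exists phi : V -> (scalar_field R s)^o, [/\ linear phi, phi a = 1 &
    exists2 B : R, 0 < B & forall x, rnorm (phi x) <= B * rnorm x].
Proof.
move=> a0; have nP := rnorm_is_norm V.
have [f [lf fle fa]] := norming_functional (a : realification V) nP.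
have fle' x : `|f x| <= rnorm x.
  rewrite ler_norml fle andbT lerNl -(scalarN _ lf) (le_trans (fle _)) //.
  by rewrite -(scaleN1r (x : realification V)) (norm_scale nP) normrN normr1 mul1r.
have [g [lg gf [c c1 gi]]] := scalar_complexification lf.
have gB x : rnorm (g x) <= 2 * rnorm x.
  apply: le_trans (rnorm_scalar_le _) _; rewrite gf mulr_natl mulr2n.
  apply: lerD => //; apply: le_trans (gi x) _.
  by apply: le_trans (fle' _) _; rewrite rnormZ c1 mul1r.
have ga : g a != 0.
  apply/eqP => ga; move: a0; rewrite -(rnorm_eq0 (v := a)) ?eqxx //.
  by rewrite -fa -gf ga /scalar_re; case: (s).
pose gai : scalar_field R s := (g a)^-1.
have gan : 0 < rnorm (gai : (scalar_field R s)^o).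
  rewrite lt_neqAle rnorm_ge0 andbT eq_sym; apply: contra_neq ga.
  by move=> /rnorm_eq0 /eqP; rewrite invr_eq0 => /eqP.
exists (fun x => gai *: g x); split.
- by move=> k x y; rewrite lg scalerDr !scalerA mulrC.
- by rewrite /gai; exact: mulVf.
exists (rnorm (gai : (scalar_field R s)^o) * 2); first by rewrite mulr_gt0.
by move=> x; rewrite rnormZ -mulrA ler_wpM2l // rnorm_ge0.
Qed.

(** * A space with p-summing identity is finite dimensional *)

Lemma powR_invK (R : realType) (p x : R) : 0 < p -> 0 <= x -> (x `^ p^-1) `^ p = x.
Proof. by move=> p0 x0; rewrite -powRrM mulVf ?gt_eqF // powRr1. Qed.

Lemma powRK_inv (R : realType) (p x : R) : 0 < p -> 0 <= x -> (x `^ p) `^ p^-1 = x.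
Proof. by move=> p0 x0; rewrite -powRrM mulfV ?gt_eqF // powRr1. Qed.

(** This inequality compares p-th powers with squares for all [p] at once, so
    that the cases [p <= 2] and [2 <= p] need not be distinguished. *)
Lemma powR_le_quadratic (R : realType) (p b d : R) :
  1 <= p -> 0 <= b <= 1 -> 0 < d -> b `^ p <= d + b ^+ 2 / d.
Proof.
move=> p1 /andP[b0 b1] d0; have [->|bn0] := eqVneq b 0.
  rewrite powR0; last by apply/lt0r_neq0/(lt_le_trans ltr01).
  by rewrite expr0n mul0r addr0 ltW.
have bgt : 0 < b by rewrite lt_neqAle eq_sym bn0.
apply: (@le_trans _ _ b); first by apply: ge1r_powR => //; rewrite bgt.
have [bd|/ltW db] := leP b d; first by apply: ler_wpDr => //; rewrite divr_ge0 ?sqr_ge0 // ltW.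
apply: ler_wpDl; first exact: ltW.
by rewrite ler_pdivlMr // expr2 ler_wpM2l.
Qed.

(** The hypothesis says that the identity is p-summing on [Z], with the supremum
    over the functionals of norm at most [B] replaced by an arbitrary upper
    bound [W].  Then the vector spaces that embed in [Z] have bounded dimension:
    the Dvoretzky-Rogers vectors of a space of dimension [2m] satisfy
    [t m <= G (d m + 4 / d)] with [t = (2 / 5) `^ p] and a constant [G], and the
    choice [d = t / (2 G)] gives [m <= 16 G ^ 2 / t ^ 2]. *)
Lemma summing_dim_bounded (R : realType) (s : scalar_kind)
    (Y : normedModType (scalar_field R s)) (Z : set Y) (p C B : R) :
  1 <= p -> 0 <= C -> 0 < B ->
  (forall m, (0 < m)%N -> forall u : 'I_m -> Y, (forall j, Z (u j)) ->
   forall W : R, 0 <= W ->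
   (forall psi : Y -> (scalar_field R s)^o, linear psi ->
      (forall y, rnorm (psi y) <= B * rnorm y) ->
      \sum_j rnorm (psi (u j)) `^ p <= W) ->
   \sum_j rnorm (u j) `^ p <= C * W) ->
  exists D : nat, forall N (L : 'rV[scalar_field R s]_N -> Y),
    linear L -> injective L -> (forall x, Z (L x)) -> (N <= D)%N.
Proof.
move=> p1 C0 B0 H.
pose t : R := (2 / 5) `^ p; have t0 : 0 < t by rewrite powR_gt0; lra.
have Bp0 : 0 < B `^ p by rewrite powR_gt0.
pose G := C * B `^ p + 1.
have G0 : 0 < G by rewrite ltr_wpDl // mulr_ge0 // ltW.
pose d := t / (2 * G); have d0 : 0 < d by rewrite divr_gt0 // mulr_gt0.
pose D := Num.bound (16 * G ^+ 2 / t ^+ 2).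
exists (D.*2.+1) => N L lL iL ZL.
rewrite leqNgt; apply/negP => DN.
have MN : ((D.+1).*2 <= N)%N by rewrite doubleS.
set m := D.+1 in MN.
(* The first 2m coordinates of 'rV_N suffice, so that L is restricted to them
   through the partial identity matrix J. *)
pose J : 'M[scalar_field R s]_(m.*2, N) := pid_mx m.*2.
have JK : J *m pid_mx m.*2 = 1%:M :> 'M[scalar_field R s]_(m.*2).
  by rewrite mul_pid_mx minnn (minn_idPr MN) pid_mx_1.
pose E (x : 'rV[R]_(m.*2)) : Y := L (map_mx (scalar_of_real s) x *m J).
have LD := linear_mapD lL.
have L0 := linear_map0 lL.
have LZ := linear_mapZ lL.
have ED x y : E (x + y) = E x + E y by rewrite /E map_mxD mulmxDl LD.
have EZ a x : E (a *: x) = scalar_of_real s a *: E x.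
  by rewrite /E map_mxZ -scalemxAl LZ.
have E0 x : E x = 0 -> x = 0.
  rewrite -L0 => /iL /(congr1 (fun z => z *m (pid_mx m.*2 : 'M[scalar_field R s]_(N, m.*2)))).
  by rewrite -mulmxA JK mulmx1 mul0mx => /eqP; rewrite map_mx_eq0 => /eqP.
pose nu x := rnorm (E x).
have nuP : is_norm nu.
  split=> [x y|a x|x /rnorm_eq0 /E0 //]; rewrite /nu.
    by rewrite ED; exact: rnorm_triangle.
  by rewrite EZ rnormZ rnorm_emb.
have [u [A [cu mA hA]]] := dvoretzky_rogers nuP.
have A0 : (0 < #|A|)%N := leq_trans (ltn0Sn D) mA.
pose v (j : 'I_#|A|) := E (row (enum_val j) u).
have nu1 i : nu (row i u) <= 1 by rewrite rowE -(enorm_delta R i); exact: cu.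
pose W := B `^ p * (d * #|A|%:R + 4 / d).
have dA0 : 0 <= d * #|A|%:R + 4 / d.
  apply: addr_ge0; first exact: mulr_ge0 (ltW d0) (ler0n _ _).
  exact: divr_ge0 (ler0n _ _) (ltW d0).
have W0 : 0 <= W by exact: mulr_ge0 (ltW Bp0) dA0.
have vW psi : linear psi -> (forall y, rnorm (psi y) <= B * rnorm y) ->
    \sum_j rnorm (psi (v j) : (scalar_field R s)^o) `^ p <= W.
  move=> lpsi hpsi; pose b i := rnorm (psi (E (row i u)) : (scalar_field R s)^o).
  have -> : \sum_j rnorm (psi (v j) : (scalar_field R s)^o) `^ p =
            \sum_(i in A) b i `^ p by rewrite [RHS]big_enum_val; apply: eq_bigr.
  (* Applied to the real part and to the imaginary part of the scalars. *)
  have weak (g : (scalar_field R s)^o -> R) :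
      (forall (r : R) z w, g (scalar_of_real s r * z + w) = r * g z + g w) ->
      (forall z, `|g z| <= rnorm z) ->
      \sum_i g (psi (E (row i u))) ^+ 2 <= B ^+ 2.
    move=> lg hg; apply: (contraction_weak_l2 (f := fun x => g (psi (E x))) nuP cu).
    - exact: ltW.
    - by move=> r x y; rewrite ED EZ lpsi lg.
    - move=> x; apply: le_trans (ler_norm _) _.
      exact: le_trans (hg _) (hpsi _).
  have wre := weak _ (@scalar_re_scalar R s) (fun z => (scalar_re_im_le z).1).
  have wim := weak _ (@scalar_im_scalar R s) (fun z => (scalar_re_im_le z).2).
  have sb : \sum_(i in A) b i ^+ 2 <= 4 * B ^+ 2.
    apply: (@le_trans _ _ (\sum_i b i ^+ 2)).
      rewrite [leRHS](bigID (mem A)) /= lerDl.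
      by apply: sumr_ge0 => i _; exact: sqr_ge0.
    apply: (@le_trans _ _ (\sum_i (2 * scalar_re (psi (E (row i u))) ^+ 2 +
                                   2 * scalar_im (psi (E (row i u))) ^+ 2))).
      apply: ler_sum => i _; set z := psi _.
      rewrite -(real_normK (num_real (scalar_re z))).
      rewrite -(real_normK (num_real (scalar_im z))).
      apply: (@le_trans _ _ ((`|scalar_re z| + `|scalar_im z|) ^+ 2)).
        by rewrite lerXn2r ?nnegrE ?addr_ge0 ?rnorm_ge0 ?rnorm_scalar_le.
      by have := sqr_ge0 (`|scalar_re z| - `|scalar_im z|); rewrite sqrrB sqrrD; lra.
    by rewrite big_split /= -!mulr_sumr; lra.
  apply: (@le_trans _ _ (\sum_(i in A) B `^ p * (d + (b i / B) ^+ 2 / d))).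
    apply: ler_sum => i _; have b0 : 0 <= b i by exact: rnorm_ge0.
    have bB : b i <= B.
      by rewrite -[leRHS]mulr1 (le_trans (hpsi _)) // ler_pM2l //; exact: nu1.
    rewrite -{1}[b i](divfK (lt0r_neq0 B0)) mulrC powRM ?(ltW B0) ?divr_ge0 ?(ltW B0) //.
    apply: ler_wpM2l; first exact: ltW.
    apply: powR_le_quadratic => //; rewrite divr_ge0 ?(ltW B0) //=.
    by rewrite ler_pdivrMr // mul1r.
  rewrite -mulr_sumr big_split /= sumr_const /W ler_pM2l // mulr_natr lerD2l.
  rewrite -mulr_suml ler_pM2r ?invr_gt0 //.
  rewrite (eq_bigr (fun i => b i ^+ 2 / B ^+ 2)) => [|i _]; last by rewrite exprMn exprVn.
  by rewrite -mulr_suml ler_pdivrMr // exprn_gt0.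
have := H _ A0 v (fun j => ZL _) W W0 vW.
have -> : \sum_j rnorm (v j) `^ p = \sum_(i in A) nu (row i u) `^ p.
  by rewrite [RHS]big_enum_val; apply: eq_bigr.
rewrite leNgt => /negP; apply.
have lower : t * #|A|%:R <= \sum_(i in A) nu (row i u) `^ p.
  rewrite mulr_natr -sumr_const; apply: ler_sum => i iA.
  rewrite ge0_ler_powR ?nnegrE ?rnorm_ge0 ?hA //; lra.
apply: lt_le_trans lower.
have big : 16 * G ^+ 2 / t ^+ 2 < #|A|%:R.
  apply: lt_le_trans (archi_boundP _) _.
    by apply: divr_ge0; [apply: mulr_ge0; [exact: ler0n|]|]; exact: sqr_ge0.
  by rewrite ler_nat (leq_trans (leqnSn D)).
have CW : C * W <= G * (d * #|A|%:R + 4 / d).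
  by rewrite /W mulrA ler_wpM2r ?lerDl.
apply: le_lt_trans CW _.
have -> : G * (d * #|A|%:R + 4 / d) = t * #|A|%:R / 2 + 8 * G ^+ 2 / t.
  by rewrite /d; field; rewrite !gt_eqF.
move: big; rewrite ltr_pdivrMr ?exprn_gt0 // => big.
suff : 8 * G ^+ 2 / t < t * #|A|%:R / 2 by lra.
by rewrite ltr_pdivrMr //; lra.
Qed.

(** * Homogeneous polynomials *)

Section Multilinear.
Variables (K : numFieldType) (X Y : lmodType K) (n : nat).
Variables (A : ('I_n -> X) -> Y).
Hypothesis lA : multilinear A.

Lemma multilinearDZ i (x : 'I_n -> X) (u v : X) (t : K) :
  A (dfwith x i (u + t *: v)) = A (dfwith x i u) + t *: A (dfwith x i v).
Proof. by rewrite addrC (lA i x t v u) addrC. Qed.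

Lemma multilinearZ i (x : 'I_n -> X) (u : X) (t : K) :
  A (dfwith x i (t *: u)) = t *: A (dfwith x i u).
Proof.
have A0 : A (dfwith x i 0) = 0.
  have := multilinearDZ i x 0 0 (-1).
  by rewrite scaler0 addr0 scaleN1r subrr.
by rewrite -[t *: u]add0r multilinearDZ A0 add0r.
Qed.

Lemma if_dfwith (T : Type) (m : nat) (om : 'I_n) (y : T) (z x : 'I_n -> T) :
  om = m :> nat ->
  (fun i : 'I_n => if (i < m)%N then z i else dfwith x om y i) =
  dfwith (fun i : 'I_n => if (i < m)%N then z i else x i) om y.
Proof.
move=> omE; apply/funext => i; case: (dfwithP (fun i : 'I_n => if (i < m)%N then z i else x i) y i).
  by rewrite omE ltnn dfwithin.
by move=> j omj; case: ifP => // _; rewrite dfwithout.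
Qed.

Lemma if_ltnS (T : Type) (m : nat) (om : 'I_n) (z x : 'I_n -> T) :
  om = m :> nat ->
  (fun i : 'I_n => if (i < m.+1)%N then z i else x i) =
  dfwith (fun i : 'I_n => if (i < m)%N then z i else x i) om (z om).
Proof.
move=> omE; rewrite -(if_dfwith _ _ _ omE); apply/funext => i.
rewrite ltnS leq_eqVlt -omE; have [//|omi|im] := ltngtP i om.
  by rewrite dfwithout // neq_ltn omi.
by rewrite (val_inj im) dfwithin.
Qed.

(** Expansion of [A (a + t u, ..., a + t u)] in powers of [t], one argument at a
    time: the first [m] arguments are replaced and the others stay arbitrary,
    which makes the induction on [m] possible. *)
Lemma multilinear_expansion (a u : X) (m : nat) : (m <= n)%N ->
  forall x, exists c : nat -> Y, [/\
    forall t : K, A (fun i => if (i < m)%N then a + t *: u else x i) =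
      \sum_(k < m.+1) t ^+ k *: c k,
    forall k, (m < k)%N -> c k = 0 &
    c 1%N = \sum_(j < n | (j < m)%N)
      A (dfwith (fun i : 'I_n => if (i < m)%N then a else x i) j u)].
Proof.
elim: m => [_ x|m IH mn x].
  exists (fun k => if k is 0%N then A x else 0); split.
  - by move=> t; rewrite big_ord1 expr0 scale1r.
  - by case.
  - by rewrite big_pred0.
pose om : 'I_n := Ordinal mn.
have [c [hc cm c1]] := IH (ltnW mn) (dfwith x om a).
have [c' [hc' c'm _]] := IH (ltnW mn) (dfwith x om u).
exists (fun k => c k + if k is k'.+1 then c' k' else 0); split.
- move=> t; rewrite (if_ltnS (om := om) (fun=> a + t *: u)) // multilinearDZ.
  rewrite -!(if_dfwith _ (fun=> a + t *: u)) // hc hc'.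
  under [RHS]eq_bigr do rewrite scalerDr.
  rewrite big_split /=; congr (_ + _).
    by rewrite [RHS]big_ord_recr /= cm // scaler0 addr0.
  rewrite [RHS]big_ord_recl /= scaler0 add0r scaler_sumr.
  by apply: eq_bigr => k _; rewrite scalerA -exprS.
- by move=> [//|k] mk; rewrite cm ?c'm ?addr0 // ltnW.
rewrite /= c1 [RHS](bigD1 om) /=; last exact: ltnSn.
rewrite [RHS]addrC; congr (_ + _).
  apply: eq_big => [j|j jm].
    by rewrite ltnS ltn_neqAle andbC.
  congr (A (dfwith _ j u)).
  by rewrite (if_ltnS (om := om) (fun=> a)) // (if_dfwith _ (fun=> a)).
have -> : c' 0%N = A (fun i : 'I_n => if (i < m)%N then a + 0 *: u else dfwith x om u i).
  rewrite hc' big_ord_recl expr0 scale1r big1 ?addr0 // => k _.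
  by rewrite exprS mul0r scale0r.
rewrite scale0r addr0 (if_ltnS (om := om) (fun=> a)) // (if_dfwith _ (fun=> a)) //.
congr A; apply/funext => i.
case: (dfwithP (fun i : 'I_n => if (i < m)%N then a else x i) u i).
  by rewrite dfwithin.
by move=> j omj; rewrite !dfwithout.
Qed.

Lemma multilinear_homogeneous (c : K) (x : X) :
  A (fun=> c *: x) = c ^+ n *: A (fun=> x).
Proof.
suff h m : (m <= n)%N ->
    A (fun i => if (i < m)%N then c *: x else x) = c ^+ m *: A (fun=> x).
  by rewrite -h //; congr A; apply/funext => i; rewrite ltn_ord.
elim: m => [_|m IH mn]; first by rewrite expr0 scale1r.
pose om : 'I_n := Ordinal mn.
rewrite (if_ltnS (om := om) (fun=> c *: x)) // multilinearZ.
rewrite -(if_dfwith x (fun=> c *: x) (fun=> x)) // exprS -scalerA -IH ?(ltnW mn) //.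
congr (_ *: A _); apply/funext => i; case: ifP => // _.
by case: (dfwithP (fun=> x) x i).
Qed.

End Multilinear.

(** Weights and nodes that extract the coefficient of degree one from every
    polynomial of degree at most [n], by inversion of a Vandermonde matrix. *)
Lemma derivative_nodes (K : numFieldType) (n : nat) :
  exists l : 'I_n.+1 -> K, exists t : 'I_n.+1 -> K,
  forall k, (k <= n)%N -> \sum_i l i * t i ^+ k = (k == 1%N)%:R.
Proof.
pose t : 'rV[K]_n.+1 := \row_i (i : nat)%:R.
pose V := Vandermonde n.+1 t.
have Vu : V \in unitmx.
  rewrite unitmxE det_Vandermonde unitfE; apply/prodf_neq0 => i _.
  apply/prodf_neq0 => j ij; rewrite !mxE subr_eq0 eqr_nat.
  by rewrite neq_ltn ij orbT.
pose e : 'cV[K]_n.+1 := \col_k (k == 1%N :> nat)%:R.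
exists (fun i => (invmx V *m e) i 0), (t 0) => k kn.
have := mulKVmx Vu e => /(congr1 (fun M : 'cV[K]_n.+1 => M (Ordinal (kn : (k < n.+1)%N)) 0)).
rewrite [X in X = _]mxE [X in _ = X]mxE /= => <-.
by apply: eq_bigr => i _; rewrite [V _ _]mxE mulrC.
Qed.

(** The combination computed by these nodes is the derivative of [q] at [a] in
    the direction [u]; it is linear in [u], whereas [q] is not. *)
Lemma homogeneous_linear_part (K : numFieldType) (X Y : lmodType K) (n : nat)
    (q : X -> Y) (l t : 'I_n.+1 -> K) (a : X) :
  homogeneous_polynomial n q ->
  (forall k, (k <= n)%N -> \sum_i l i * t i ^+ k = (k == 1%N)%:R) ->
  linear (fun u => \sum_i l i *: q (a + t i *: u)).
Proof.
move=> [A lA qA] hl.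
have E u : \sum_i l i *: q (a + t i *: u) = \sum_(j < n) A (dfwith (fun=> a) j u).
  have [c [hc cn c1]] := multilinear_expansion lA a u (leqnn n) (fun=> a).
  have hq (r : K) : q (a + r *: u) = \sum_(k < n.+1) r ^+ k *: c k.
    by rewrite qA -hc; congr A; apply/funext => i; rewrite ltn_ord.
  transitivity (c 1%N); last first.
    rewrite c1; apply: eq_big => [j|j _]; first exact: ltn_ord.
    by congr (A (dfwith _ j u)); apply/funext => i; rewrite ltn_ord.
  transitivity (\sum_(k < n.+1) (k == 1%N :> nat)%:R *: c k).
    under eq_bigr do rewrite hq scaler_sumr.
    rewrite exchange_big /=; apply: eq_bigr => k _.
    under eq_bigr do rewrite scalerA.
    by rewrite -scaler_suml hl // -ltnS.
  have [n0|n0] := posnP n.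
    rewrite (cn 1%N) ?n0 // big1 // => k _.
    by rewrite ord1 scale0r.
  pose o1 : 'I_n.+1 := Ordinal (n0 : (1 < n.+1)%N).
  rewrite (bigD1 o1) //= scale1r big1 ?addr0 // => k ko.
  by rewrite -[1%N]/(o1 : nat) (inj_eq val_inj) (negPf ko) scale0r.
move=> r u v; rewrite !E scaler_sumr -big_split /=.
by apply: eq_bigr => j _; exact: (lA j (fun=> a) r u v).
Qed.

Lemma polynomial_growth (R : realType) (s : scalar_kind)
    (X Y : normedModType (scalar_field R s)) (n : nat) (q : X -> Y) (b r : R) (x : X) :
  homogeneous_polynomial n q -> (forall y, rnorm y <= 1 -> rnorm (q y) <= b) ->
  0 < r -> rnorm x <= r -> rnorm (q x) <= r ^+ n * b.
Proof.
move=> [A lA qA] hq r0 xr.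
pose e : scalar_field R s := scalar_of_real s r.
have e0 : e != 0 by rewrite fmorph_eq0 gt_eqF.
have -> : q x = e ^+ n *: q (e^-1 *: x).
  by rewrite !qA -(multilinear_homogeneous lA) scalerA mulfV // scale1r.
rewrite /e -rmorphXn rnormZ rnorm_emb ger0_norm ?exprn_ge0 ?(ltW r0) //.
apply: ler_wpM2l; first by rewrite exprn_ge0 // ltW.
apply: hq; rewrite -fmorphV rnormZ rnorm_emb gtr0_norm ?invr_gt0 //.
by rewrite mulrC ler_pdivrMr // mul1r.
Qed.

Lemma polynomial_norm_le1 (R : realType) (s : scalar_kind)
    (X Y : normedModType (scalar_field R s)) (q : X -> Y) :
  (polynomial_norm q <= 1%:E)%E <-> forall y, rnorm y <= 1 -> rnorm (q y) <= 1.
Proof.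
split=> [h y y1|h].
  rewrite -lee_fin; apply: le_trans h; apply: ereal_sup_ubound.
  by exists y.
by apply: ge_ereal_sup => _ [y y1 <-]; rewrite lee_fin; exact: h.
Qed.

(** * From summing polynomials to finite dimension *)

Lemma power_times_vector_continuous (K : numFieldType) (V : normedModType K)
    (phi : V -> K^o) (n : nat) :
  continuous phi -> continuous (fun x : V => (phi x : K) ^+ n *: x).
Proof.
move=> cphi; elim: n => [|n IH] x.
  under eq_fun do rewrite expr0 scale1r.
  exact: cvg_id.
under eq_fun do rewrite exprS -scalerA.
by apply: cvgZ; [exact: cphi|exact: IH].
Qed.

Lemma power_times_vector_multilinear (K : numFieldType) (V : lmodType K)
    (phi : V -> K^o) (n : nat) : linear phi ->
  multilinear (fun x : 'I_n.+1 -> V =>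
    (\prod_(i < n.+1 | i != ord0) (phi (x i) : K)) *: x ord0).
Proof.
move=> lphi i x k u v /=.
have out j w : i != j -> dfwith x i w j = x j by exact: dfwithout.
have [i0|i0] := eqVneq i ord0.
  have prodE w : \prod_(j < n.+1 | j != ord0) (phi (dfwith x i w j) : K) =
                 \prod_(j < n.+1 | j != ord0) (phi (x j) : K).
    by apply: eq_bigr => j j0; rewrite out // i0 eq_sym.
  by rewrite !prodE -i0 !dfwithin scalerDr !scalerA mulrC.
have prodE w : \prod_(j < n.+1 | j != ord0) (phi (dfwith x i w j) : K) =
   phi w * \prod_(j < n.+1 | (j != ord0) && (j != i)) (phi (x j) : K).
  rewrite (bigD1 i) //= dfwithin; congr (_ * _).
  by apply: eq_bigr => j /andP[_ ji]; rewrite out // eq_sym.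
rewrite !prodE !out // lphi !scalerA -scalerDl; congr (_ *: _).
by rewrite mulrDl mulrA.
Qed.

Section FiniteDimension.
Variables (K : numFieldType) (Y : lmodType K).

(** Existence of [d] linearly independent vectors whose span lies in [Z],
    encoded as an injective linear map from ['rV_d]. *)
Definition free_family (Z : set Y) (d : nat) :=
  exists L : 'rV[K]_d -> Y, [/\ linear L, injective L & forall x, Z (L x)].

(** The map [L] extended by sending one more basis vector to [z]. *)
Definition adjoin (d : nat) (L : 'rV[K]_d -> Y) (z : Y) (x : 'rV[K]_(d + 1)) : Y :=
  L (lsubmx x) + rsubmx x 0 0 *: z.

Lemma adjoin_linear d (L : 'rV[K]_d -> Y) z : linear L -> linear (adjoin L z).
Proof.
move=> lL k x y; rewrite /adjoin !linearP /= lL !mxE scalerDl scalerDr -!scalerA.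
by rewrite addrACA.
Qed.

Lemma adjoin_injective d (L : 'rV[K]_d -> Y) z :
  linear L -> injective L -> (forall x, z <> L x) -> injective (adjoin L z).
Proof.
move=> lL iL zL.
have LD := linear_mapD lL.
have L0 := linear_map0 lL.
have LZ := linear_mapZ lL.
apply: linear_injective; first exact: adjoin_linear.
move=> x; rewrite /adjoin; set c := rsubmx x 0 0.
have [c0|c0] := eqVneq c 0.
  rewrite c0 scale0r addr0 -L0 => /iL xl; rewrite -[x]hsubmxK xl.
  have -> : rsubmx x = 0 by apply/rowP => i; rewrite ord1 [RHS]mxE -[LHS]/c.
  by rewrite row_mx0.
move=> /eqP; rewrite addrC addr_eq0 => /eqP cz; exfalso.
apply: (zL (- c^-1 *: lsubmx x)).
by rewrite LZ scaleNr -scalerN -cz scalerA mulVf // scale1r.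
Qed.

(** A free family of maximal size in the kernel of [phi] spans this kernel, and
    together with [a] it gives a basis of [Y]. *)
Lemma bounded_kernel_finite_dimensional (phi : Y -> K^o) (a : Y) (D : nat) :
  linear phi -> phi a = 1 ->
  (forall d, free_family [set y | phi y = 0] d -> (d <= D)%N) ->
  finite_dimensional Y.
Proof.
move=> lphi pa hD; set Z := [set y | phi y = 0].
have pD := linear_mapD lphi.
have p0 := linear_map0 lphi.
have pZ := linear_mapZ lphi.
have ex0 : exists d, `[< free_family Z d >].
  exists 0%N; apply/asboolP; exists (fun=> 0); split => //.
  - by move=> k x y; rewrite scaler0 addr0.
  - by move=> x y _; rewrite (thinmx0 x) (thinmx0 y).
have hDb d : `[< free_family Z d >] -> (d <= D)%N by move=> /asboolP /hD.
have [d /asboolP[L [lL iL ZL]] dmax] := ex_maxnP ex0 hDb.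
have kerL z : phi z = 0 -> exists x, z = L x.
  move=> pz; apply: contrapT => no.
  have : free_family Z (d + 1).
    exists (adjoin L z); split.
    - exact: adjoin_linear.
    - by apply: adjoin_injective => // x zx; apply: no; exists x.
    - by move=> x; rewrite /Z /= pD pZ pz scaler0 addr0; exact: ZL.
  by move=> /asboolP /dmax; rewrite addn1 ltnn.
have laL : linear (adjoin L a) by exact: adjoin_linear.
have iaL : injective (adjoin L a).
  apply: adjoin_injective => // x ax; have : phi a = 0 by rewrite ax; exact: ZL.
  by rewrite pa => /eqP; rewrite oner_eq0.
have saL y : exists x, adjoin L a x = y.
  have [x hx] : exists x, y - phi y *: a = L x.
    apply: kerL; rewrite pD -scaleNr pZ pa scaleNr.
    by rewrite [X in _ - X]mulr1 subrr.
  exists (row_mx x (phi y)%:M).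
  by rewrite /adjoin row_mxKl row_mxKr mxE eqxx mulr1n -hx subrK.
have [g hg] := choice saL.
exists (d + 1)%N, g; last by exists (adjoin L a) => // x; apply: iaL; rewrite hg.
by move=> k x y; apply: iaL; rewrite laL !hg.
Qed.

End FiniteDimension.

Lemma bounded_functional_continuous (R : realType) (s : scalar_kind)
    (V : normedModType (scalar_field R s)) (phi : V -> (scalar_field R s)^o) (B : R) :
  linear phi -> (forall x, rnorm (phi x) <= B * rnorm x) -> continuous phi.
Proof.
move=> lphi hB.
pose F : {linear V -> (scalar_field R s)^o} :=
  HB.pack phi (GRing.isLinear.Build _ _ _ _ phi lphi).
rewrite -[phi]/(F : _ -> _); apply: bounded_linear_continuous.
apply/linear_boundedP; exists (scalar_of_real s B); split.
  by rewrite realE -(rmorph0 (scalar_of_real s)) !ler_scalar_of_real le_total.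
move=> r Br x; rewrite -[`|F x|]rnormE -[`|x|]rnormE.
apply: le_trans (_ : scalar_of_real s B * scalar_of_real s (rnorm x) <= _).
  by rewrite -rmorphM ler_scalar_of_real hB.
apply: ler_wpM2r (ltW Br).
by rewrite -(rmorph0 (scalar_of_real s)) ler_scalar_of_real rnorm_ge0.
Qed.

(** In the proof [psi q] is the derivative at [a] of a scalar polynomial [q],
    [psiB] bounds it uniformly in [q], and [psiP] says that the derivative of [P]
    in the direction of a vector of the kernel of [phi] is that vector. *)
Lemma summing_implies_finite_dimensional (R : realType) (s : scalar_kind) (p : R)
    (n : nat) (Y : normedModType (scalar_field R s)) :
  1 <= p -> (1 <= n)%N ->
  (forall P : Y -> Y, continuous_polynomial n P ->
     factorable_strongly_summing p n P) ->
  finite_dimensional Y.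
Proof.
move=> p1; case: n => [//|n] _ H.
have p0 : 0 < p := lt_le_trans ltr01 p1.
(* Hahn-Banach needs a nonzero vector; the zero space has dimension 0. *)
have [[a a0]|Y0] := pselect (exists a : Y, a != 0); last first.
  exists 0%N; exists (fun=> 0); first by move=> k x y; rewrite scaler0 addr0.
  exists (fun=> 0) => x; last by rewrite thinmx0.
  by apply/eqP; rewrite eq_sym; apply/negPn/negP => x0; apply: Y0; exists x.
have [phi [lphi pa [Bphi _ hphi]]] := dual_functional a0.
pose P (x : Y) : Y := (phi x : scalar_field R s) ^+ n *: x.
have cP : continuous_polynomial n.+1 P.
  split; last first.
    apply: power_times_vector_continuous.
    exact: bounded_functional_continuous hphi.
  exists (fun x : 'I_n.+1 -> Y =>
    (\prod_(i < n.+1 | i != ord0) (phi (x i) : scalar_field R s)) *: x ord0).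
    exact: power_times_vector_multilinear.
  move=> x; rewrite /P prodr_const (_ : #|_| = n) //.
  have := cardC1 (ord0 : 'I_n.+1); rewrite card_ord /= => n_eq.
  by rewrite -[RHS]n_eq; apply: eq_card => i; rewrite !inE.
have [C C0 hC] := H P cP.
have [l [t lt]] := derivative_nodes (scalar_field R s) n.+1.
pose rl i : R := rnorm (l i : (scalar_field R s)^o).
pose rt i : R := rnorm (t i : (scalar_field R s)^o).
pose rho := 1 + rnorm a + \sum_i rt i.
have rt0 i : 0 <= rt i by exact: rnorm_ge0.
have rl0 i : 0 <= rl i by exact: rnorm_ge0.
have rho0 : 0 < rho.
  by rewrite /rho -addrA ltr_pwDl // addr_ge0 ?rnorm_ge0 ?sumr_ge0.
pose B := 1 + \sum_i rl i * rho ^+ n.+1.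
have B0 : 0 < B.
  rewrite ltr_pwDl // sumr_ge0 // => i _.
  by rewrite mulr_ge0 // exprn_ge0 // ltW.
pose psi (q : Y -> (scalar_field R s)^o) (u : Y) : (scalar_field R s)^o :=
  \sum_i l i *: q (a + t i *: u).
have psiB q : homogeneous_polynomial n.+1 q -> (polynomial_norm q <= 1%:E)%E ->
    linear (psi q) /\ forall u, rnorm (psi q u) <= B * rnorm u.
  move=> hq /polynomial_norm_le1 q1.
  have lpsi : linear (psi q) by exact: homogeneous_linear_part.
  split=> // u; have nP := rnorm_is_norm Y.
  have nK := rnorm_is_norm ((scalar_field R s)^o).
  have unit v : rnorm v <= 1 -> rnorm (psi q v) <= B.
    move=> v1; apply: le_trans (norm_sum nK _ _ _) _.
    apply: (@le_trans _ _ (\sum_i rl i * rho ^+ n.+1)); last by rewrite lerDr.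
    apply: ler_sum => i _; rewrite rnormZ; apply: (ler_wpM2l (rl0 i)).
    rewrite -[leRHS]mulr1; apply: (polynomial_growth hq q1 rho0).
    apply: le_trans (rnorm_triangle _ _) _.
    have tv : rnorm (t i *: v) <= \sum_i rt i.
      rewrite rnormZ; apply: (@le_trans _ _ (rt i)); first by rewrite ler_piMr ?rt0.
      by rewrite (bigD1 i) //= lerDl sumr_ge0.
    by rewrite /rho; lra.
  have [u0|u0] := eqVneq (rnorm u) 0.
    by rewrite (rnorm_eq0 u0) (linear_map0 lpsi) (norm_at0 nK) (norm_at0 nP) mulr0.
  have ru : 0 < rnorm u by rewrite lt_neqAle eq_sym u0 rnorm_ge0.
  pose v := scalar_of_real s (rnorm u)^-1 *: u.
  have v1 : rnorm v = 1 by rewrite /v rnormZ rnorm_emb gtr0_norm ?invr_gt0 // mulVf.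
  have uv : u = scalar_of_real s (rnorm u) *: v.
    by rewrite /v scalerA -rmorphM mulfV // rmorph1 scale1r.
  rewrite {1}uv (linear_mapZ lpsi) rnormZ rnorm_emb gtr0_norm // mulrC ler_pM2r //.
  by apply: unit; rewrite v1.
have psiP u : phi u = 0 -> \sum_i l i *: P (a + t i *: u) = u.
  move=> pu.
  have PE i : P (a + t i *: u) = a + t i *: u.
    rewrite /P [a + _]addrC lphi pu pa scaler0 add0r.
    by rewrite expr1n scale1r.
  under eq_bigr do rewrite PE scalerDr scalerA.
  rewrite big_split /= -!scaler_suml.
  have := lt 0%N isT; under eq_bigr do rewrite expr0 mulr1.
  move=> ->; have := lt 1%N isT; under eq_bigr do rewrite expr1.
  by move=> ->; rewrite scale0r add0r scale1r.
pose Z := [set y | phi y = 0].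
have summ m : (0 < m)%N -> forall u : 'I_m -> Y, (forall j, Z (u j)) ->
    forall W : R, 0 <= W ->
    (forall psi : Y -> (scalar_field R s)^o, linear psi ->
      (forall y, rnorm (psi y) <= B * rnorm y) ->
      \sum_j rnorm (psi (u j)) `^ p <= W) ->
    \sum_j rnorm (u j) `^ p <= C `^ p * W.
  move=> m0 u Zu W W0 hW.
  have := hC m n.+2 m0 isT (fun j i => a + t i *: u j) (fun _ i => l i).
  have le1 : (ereal_sup [set (lp_combination p (fun (_ : 'I_m) i => l i)
      (fun j i => a + t i *: u j) q)%:E |
      q in [set q : Y -> (scalar_field R s)^o |
        continuous_polynomial n.+1 q /\ (polynomial_norm q <= 1%:E)%E]]
      <= (W `^ p^-1)%:E)%E.
    apply: ge_ereal_sup => _ [q [[hq _] q1] <-]; rewrite lee_fin.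
    have [lq bq] := psiB q hq q1.
    apply: ge0_ler_powR; rewrite ?nnegrE ?invr_ge0 ?(ltW p0) //.
      by apply: sumr_ge0 => j _; exact: powR_ge0.
    exact: hW lq bq.
  move=> /le_trans /(_ (lee_wpmul2l _ le1)); rewrite lee_fin => /(_ C0).
  rewrite -EFinM lee_fin /lp_combination.
  under eq_bigr do rewrite psiP ?Zu //.
  set S := \sum_j _ => SW.
  have S0 : 0 <= S by apply: sumr_ge0 => j _; exact: powR_ge0.
  rewrite -[S](powR_invK p0) // -[W](powR_invK p0) // -powRM ?powR_ge0 //.
  by apply: ge0_ler_powR => //; rewrite ?nnegrE ?mulr_ge0 ?powR_ge0 // ltW.
have [D hD] := summing_dim_bounded p1 (powR_ge0 C p) B0 summ.
apply: (@bounded_kernel_finite_dimensional _ _ phi a D) => // d [L [lL iL ZL]].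
exact: hD lL iL ZL.
Qed.

(** * From finite dimension to summing polynomials *)

Lemma embedded_coord_bounded (R : realType) (s : scalar_kind) (d : nat)
    (Y : normedModType (scalar_field R s)) (E : 'rV[R]_d -> Y) :
  (forall x y, E (x + y) = E x + E y) ->
  (forall a x, E (a *: x) = scalar_of_real s a *: E x) ->
  (forall x, E x = 0 -> x = 0) ->
  exists2 c : R, 0 < c & forall (x : 'rV[R]_d) i, `|x 0 i| <= c * rnorm (E x).
Proof.
move=> ED EZ E0; apply: (@coord_le_norm _ _ (fun x => rnorm (E x))).
split=> [x y|a x|x /rnorm_eq0 /E0 //].
  by rewrite ED; exact: rnorm_triangle.
by rewrite EZ rnormZ rnorm_emb.
Qed.

(** Coordinates on a finite dimensional normed space are bounded.  Over the
    complex numbers the space is parametrized by real and imaginary parts, that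
    is, by real row vectors of length [d + d]. *)
Lemma coordinate_bounded (R : realType) (s : scalar_kind) (d : nat)
    (Y : normedModType (scalar_field R s)) (g : 'rV[scalar_field R s]_d -> Y) :
  linear g -> injective g ->
  exists2 M : R, 0 < M & forall (z : 'rV[scalar_field R s]_d) k,
    rnorm (z 0 k : (scalar_field R s)^o) <= M * rnorm (g z).
Proof.
case: s Y g => Y g lg ig.
all: have gD := linear_mapD lg.
all: have g0 := linear_map0 lg.
all: have gZ := linear_mapZ lg.
- have [|||c c0 hc] := @embedded_coord_bounded R RealScalars d Y g.
  + exact: gD.
  + exact: gZ.
  + by move=> x; rewrite -g0 => /ig.
  by exists c => // z k; exact: hc.
pose E (x : 'rV[R]_(d + d)) : Y :=
  g (map_mx (real_complex R) (lsubmx x) + 'i%C *: map_mx (real_complex R) (rsubmx x)).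
have [|||c c0 hc] := @embedded_coord_bounded R ComplexScalars (d + d) Y E.
- by move=> x y; rewrite /E !linearD /= !map_mxD scalerDr addrACA gD.
- move=> a x; rewrite /E !linearZ /= !map_mxZ scalerA mulrC -scalerA -scalerDr.
  exact: gZ.
- move=> x; rewrite /E -g0 => /ig h; rewrite -[x]hsubmxK.
  have hk k : lsubmx x 0 k = 0 /\ rsubmx x 0 k = 0.
    have := congr1 (fun M : 'rV[R[i]%C]_d => M 0 k) h.
    rewrite !mxE => /eqP; rewrite eq_complex /= => /andP[/eqP h1 /eqP h2].
    by split; [move: h1|move: h2]; rewrite ?mxE; lra.
  have -> : lsubmx x = 0 by apply/rowP => k; rewrite (hk k).1 mxE.
  have -> : rsubmx x = 0 by apply/rowP => k; rewrite (hk k).2 mxE.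
  exact: row_mx0.
exists (c + c) => [|z k]; first exact: addr_gt0.
pose x : 'rV[R]_(d + d) := row_mx (map_mx (@complex.Re R) z) (map_mx (@complex.Im R) z).
have Ex : E x = g z.
  rewrite /E row_mxKl row_mxKr; congr g; apply/rowP => i; rewrite !mxE.
  exact/esym/complexE.
apply: le_trans (rnorm_scalar_le _) _; rewrite mulrDl -Ex; apply: lerD.
  by have := hc x (lshift d k); rewrite /x row_mxEl mxE.
by have := hc x (rshift d k); rewrite /x row_mxEr mxE.
Qed.

Lemma polynomial_bounded (R : realType) (s : scalar_kind)
    (X Y : normedModType (scalar_field R s)) (n : nat) (P : X -> Y) :
  continuous_polynomial n P ->
  exists2 b : R, 0 < b & forall y, rnorm y <= 1 -> rnorm (P y) <= b.
Proof.
move=> [[A lA PA] cP].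
have /cvgrPdist_lt /(_ 1 ltr01) /nbhs_norm0P[e /= e0 he] := cP 0.
pose r := scalar_re e / 2.
have re : scalar_of_real s (scalar_re e) = e by exact: scalar_re_eq (ltW e0).
have r0 : 0 < r.
  rewrite divr_gt0 // ltNge; apply/negP => re0; move: e0.
  by rewrite -re le_gtF // -(rmorph0 (scalar_of_real s)) ler_scalar_of_real.
have small y : rnorm y <= r -> rnorm (P y) <= 1 + rnorm (P 0).
  move=> yr; have yE : `|y| < e.
    rewrite -rnormE -re lt_neqAle ler_scalar_of_real (inj_eq (fmorph_inj _)).
    rewrite -lt_neqAle; apply: le_lt_trans yr _; move: r0; rewrite /r; lra.
  have := he _ yE; rewrite distrC => /ltW; rewrite -rnormE -(rmorph1 (scalar_of_real s)).
  rewrite ler_scalar_of_real => h; rewrite -[P y](subrK (P 0)).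
  by apply: le_trans (rnorm_triangle _ _) _; rewrite lerD2r.
exists ((1 + rnorm (P 0)) / r ^+ n).
  by rewrite divr_gt0 ?exprn_gt0 // ltr_pwDl // rnorm_ge0.
move=> y y1; rewrite ler_pdivlMr ?exprn_gt0 // mulrC.
have <- : rnorm (P (scalar_of_real s r *: y)) = r ^+ n * rnorm (P y).
  rewrite !PA (multilinear_homogeneous lA) -rmorphXn rnormZ rnorm_emb.
  by rewrite ger0_norm // exprn_ge0 // ltW.
apply: small; rewrite rnormZ rnorm_emb gtr0_norm //.
by rewrite ler_piMr // ltW.
Qed.

Lemma powR_sum_le (R : realType) (p : R) (d : nat) (b : 'I_d -> R) :
  0 < p -> (forall k, 0 <= b k) ->
  (\sum_k b k) `^ p <= d.+1%:R `^ p * \sum_k b k `^ p.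
Proof.
move=> p0 b0; set T := \sum_k b k `^ p.
have T0 : 0 <= T by apply: sumr_ge0 => k _; exact: powR_ge0.
rewrite -[X in _ <= _ * X](powR_invK p0) // -powRM ?powR_ge0 //.
apply: ge0_ler_powR; rewrite ?nnegrE ?(ltW p0) ?mulr_ge0 ?powR_ge0 ?sumr_ge0 //.
apply: (@le_trans _ _ (\sum_(k < d) T `^ p^-1)).
  apply: ler_sum => k _; rewrite -[leLHS](powRK_inv p0) //.
  apply: ge0_ler_powR; rewrite ?nnegrE ?invr_ge0 ?(ltW p0) ?powR_ge0 //.
  by rewrite /T (bigD1 k) //= lerDl; apply: sumr_ge0 => j _; exact: powR_ge0.
rewrite sumr_const card_ord -[leLHS]mulr_natl ler_wpM2r ?powR_ge0 //.
by rewrite ler_nat.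
Qed.

Lemma polynomial_comp_linear (K : numFieldType) (X Y Z : normedModType K) (n : nat)
    (P : X -> Y) (f : Y -> Z) :
  continuous_polynomial n P -> linear f -> continuous f ->
  continuous_polynomial n (fun x => f (P x)).
Proof.
move=> [[A lA PA] cP] lf cf; split.
  exists (fun x => f (A x)) => [i x k u v|x]; last by rewrite PA.
  by rewrite (lA i x k u v) lf.
by move=> x; apply: continuous_comp; [exact: cP|exact: cf].
Qed.

Lemma polynomial0 (K : numFieldType) (X Y : normedModType K) (n : nat) :
  continuous_polynomial n (fun _ : X => 0 : Y).
Proof.
split; last by move=> x; exact: cvg_cst.
by exists (fun=> 0) => // i x k u v; rewrite scaler0 addr0.
Qed.

(** Each coordinate of [P], divided by [M * b], is a scalar polynomial of norm
    at most 1; the norm of [Y] is at most [Q] times the sum of the absolute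
    values of these rescaled coordinates. *)
Lemma finite_dimensional_implies_summing (R : realType) (s : scalar_kind) (p : R)
    (n : nat) (X Y : normedModType (scalar_field R s)) (P : X -> Y) :
  1 <= p -> finite_dimensional Y -> continuous_polynomial n P ->
  factorable_strongly_summing p n P.
Proof.
move=> p1 [d [v lv [g vK gK]]] cP.
have p0 : 0 < p := lt_le_trans ltr01 p1.
have pi0 : 0 <= p^-1 by rewrite invr_ge0 ltW.
have lg : linear g by move=> k x y; apply: (can_inj vK); rewrite lv !gK.
have gD := linear_mapD lg.
have g0 := linear_map0 lg.
have gZ := linear_mapZ lg.
have [M M0 hM] := coordinate_bounded lg (can_inj gK).
have [b b0 hb] := polynomial_bounded cP.
have nP := rnorm_is_norm Y.
pose c := scalar_of_real s (M * b)^-1.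
pose phi k (y : Y) : (scalar_field R s)^o := c * v y 0 k.
have lphi k : linear (phi k).
  move=> a x y; rewrite /phi lv !mxE mulrDr; congr (_ + _).
  by rewrite /GRing.scale /= mulrCA.
have phiB k y : rnorm (phi k y) <= b^-1 * rnorm y.
  rewrite [leLHS](rnormZ c (v y 0 k : (scalar_field R s)^o)) rnorm_emb.
  rewrite gtr0_norm ?invr_gt0 ?mulr_gt0 // invfM -mulrA mulrCA ler_pM2l ?invr_gt0 //.
  by rewrite ler_pdivrMl // -{2}(vK y).
pose q k (x : X) := phi k (P x).
have cq k : continuous_polynomial n (q k).
  apply: polynomial_comp_linear => //.
  exact: bounded_functional_continuous (phiB k).
have q1 k : (polynomial_norm (q k) <= 1%:E)%E.
  apply/polynomial_norm_le1 => x x1; apply: le_trans (phiB k _) _.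
  by rewrite ler_pdivrMl // mulr1 hb.
pose Q : R := M * b * \sum_k rnorm (g (delta_mx 0 k)).
have Q0 : 0 <= Q.
  by rewrite !mulr_ge0 ?(ltW M0) ?(ltW b0) // sumr_ge0 // => k _; exact: rnorm_ge0.
have hQ y : rnorm y <= Q * \sum_k rnorm (phi k y).
  have yE : y = \sum_k v y 0 k *: g (delta_mx 0 k).
    rewrite -{1}(vK y) {1}(row_sum_delta (v y)).
    by rewrite (big_morph g gD g0); apply: eq_bigr => k _; exact: gZ.
  rewrite {1}yE; apply: le_trans (norm_sum nP _ _ _) _.
  rewrite /Q mulrAC mulr_sumr; apply: ler_sum => k _; rewrite rnormZ.
  apply: ler_wpM2r; first exact: rnorm_ge0.
  have -> : rnorm (v y 0 k : (scalar_field R s)^o) = M * b * rnorm (phi k y).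
    rewrite [X in _ = _ * X](rnormZ c (v y 0 k : (scalar_field R s)^o)) rnorm_emb.
    rewrite gtr0_norm ?invr_gt0 ?mulr_gt0 // mulrA mulfV ?mul1r //.
    by rewrite gt_eqF // mulr_gt0.
  apply: ler_wpM2l; first by rewrite mulr_ge0 // ltW.
  by rewrite (bigD1 k) //= lerDl; apply: sumr_ge0 => j _; exact: rnorm_ge0.
pose D : R := d.+1%:R.
pose C0 : R := Q `^ p * D `^ p * D.
have C00 : 0 <= C0 by rewrite /C0 !mulr_ge0 ?powR_ge0 /D ?ler0n.
exists (C0 `^ p^-1 + 1) => [|m1 m2 m10 m20 x l]; first by rewrite addr_ge0 ?powR_ge0.
set S := ereal_sup _.
have leS (r : X -> (scalar_field R s)^o) :
    continuous_polynomial n r -> (polynomial_norm r <= 1%:E)%E ->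
    ((lp_combination p l x r)%:E <= S)%E.
  by move=> cr r1; apply: ereal_sup_ubound; exists r.
have S0 : (0 <= S)%E.
  apply: le_trans (leS _ (polynomial0 _ _ _) _); first by rewrite lee_fin powR_ge0.
  apply/polynomial_norm_le1 => y _.
  by rewrite (norm_at0 (rnorm_is_norm ((scalar_field R s)^o))).
have CC : 0 < C0 `^ p^-1 + 1 by rewrite ltr_wpDl // powR_ge0.
move: S leS S0 => [S| |] leS S0; last by [].
  2: by rewrite gt0_muley ?lte_fin ?leey.
rewrite lee_fin in S0; rewrite -EFinM lee_fin.
apply: (@le_trans _ _ (C0 `^ p^-1 * S)); last by rewrite ler_wpM2r // lerDl.
pose w j := \sum_i l j i *: P (x j i).
have phiw k j : phi k (w j) = \sum_i l j i *: q k (x j i).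
  rewrite /w (big_morph (phi k) (linear_mapD (lphi k)) (linear_map0 (lphi k))).
  by apply: eq_bigr => i _; exact: (linear_mapZ (lphi k)).
have Sk k : \sum_j rnorm (phi k (w j)) `^ p <= S `^ p.
  have := leS _ (cq k) (q1 k); rewrite lee_fin /lp_combination => h.
  set T := \sum_j _.
  have T0 : 0 <= T by apply: sumr_ge0 => j _; exact: powR_ge0.
  rewrite -[T](powR_invK p0) //.
  apply: ge0_ler_powR.
  - exact: ltW.
  - by rewrite nnegrE powR_ge0.
  - by rewrite nnegrE.
  by apply: le_trans h; rewrite /T; under eq_bigr do rewrite phiw.
have main : \sum_j rnorm (w j) `^ p <= C0 * S `^ p.
  apply: (@le_trans _ _ (\sum_j Q `^ p * (D `^ p * \sum_k rnorm (phi k (w j)) `^ p))).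
    apply: ler_sum => j _.
    apply: (@le_trans _ _ ((Q * \sum_k rnorm (phi k (w j))) `^ p)).
      apply: ge0_ler_powR; rewrite ?nnegrE ?rnorm_ge0 ?(ltW p0) ?hQ //.
      by rewrite mulr_ge0 // sumr_ge0 // => k _; exact: rnorm_ge0.
    rewrite powRM //; last by apply: sumr_ge0 => k _; exact: rnorm_ge0.
    apply: ler_wpM2l; first exact: powR_ge0.
    by apply: powR_sum_le => // k; exact: rnorm_ge0.
  rewrite -!mulr_sumr exchange_big /= /C0 -!mulrA.
  apply: ler_wpM2l; first exact: powR_ge0.
  apply: ler_wpM2l; first exact: powR_ge0.
  apply: (@le_trans _ _ (\sum_(k < d) S `^ p)); first by apply: ler_sum.
  rewrite sumr_const card_ord -[leLHS]mulr_natl ler_wpM2r ?powR_ge0 //.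
  by rewrite ler_nat.
rewrite /lp_combination -[S in _ * S](powRK_inv p0) //.
rewrite -powRM ?powR_ge0 //; apply: ge0_ler_powR => //.
- by rewrite nnegrE; apply: sumr_ge0 => j _; exact: powR_ge0.
- by rewrite nnegrE mulr_ge0 ?powR_ge0.
Qed.

Theorem theorem5p10 (R : realType) (s : scalar_kind) (p : R) (n : nat)
    (Y : completeNormedModType (scalar_field R s)) :
  1 <= p -> (1 <= n)%N ->
  (forall P : Y -> Y, continuous_polynomial n P ->
     factorable_strongly_summing p n P) <->
  finite_dimensional Y.
Proof.
move=> p1 n1; split; first exact: summing_implies_finite_dimensional.
by move=> fY P; exact: finite_dimensional_implies_summing.
Qed.
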